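(* Let $1\le q<\infty$, let $X$ be a complex Banach space, let $U=\mathbb C$, and let $A$ generate a $C_0$-semigroup $(T(t))_{t\ge0}$ on $X$. Assume that $A$ possesses a $q$-Riesz basis of $X$ that consists of eigenvectors $(e_n)_{n\in\mathbb N}$ with eigenvalues $(\lambda_n)_{n\in\mathbb N}$ lying in a sector in the open left half-plane $\mathbb C_-$ with $\sup_n\operatorname{Re}(\lambda_n)<0$, and let $B$ be a bounded linear operator from $\mathbb C$ to $X_{-1}$. Then the system $\Sigma(A,B)$ is $L^\infty$-iISS, and hence also $L^\infty$-ISS and $L^\infty$-zero-class admissible.
   Context: $q$-Riesz basis. $(e_n)_{n\in\mathbb N}$ is a $q$-Riesz basis of $X$ if it is a Schauder basis and there are constants $c_1,c_2>0$ with $c_1\sum_k|a_k|^q\le\left\|\sum_ka_ke_k\right\|^q\le c_2\sum_k|a_k|^q$ for all sequences $(a_k)_{k\in\mathbb N}\in\ell^q(\mathbb N)$. Eigenvalues: $Ae_n=\lambda_ne_n$. ''Lying in a sector in the open left half-plane'' means $\operatorname{Re}\lambda_n<0$ for all $n$ and there is a constant $k>0$ with $|\operatorname{Im}\lambda_n|\le k|\operatorname{Re}\lambda_n|$ for all $n\in\mathbb N$. System. $X_{-1}$ is the completion of $X$ with respect to $\|x\|_{X_{-1}}=\|(\beta-A)^{-1}x\|_X$ for some $\beta\in\rho(A)$; $(T(t))_{t\ge0}$ extends uniquely to a $C_0$-semigroup $(T_{-1}(t))_{t\ge0}$ on $X_{-1}$, whose generator $A_{-1}$ extends $A$. $\Sigma(A,B)$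 denotes the system $\dot x(t)=Ax(t)+Bu(t)$, $x(0)=x_0$, $t\ge 0$. Its mild solution for $x_0\in X$ and input $u$ is $x(t)=T(t)x_0+\int_0^tT_{-1}(t-s)Bu(s)\,ds$, which in general is an element of $X_{-1}$. $\|\cdot\|$ without index is the norm of $X$. Comparison functions ($\mathbb R_0^+=[0,\infty)$). $\mathcal K$: functions $\mu:\mathbb R_0^+\to\mathbb R_0^+$ that are continuous, strictly increasing, with $\mu(0)=0$. $\mathcal K_\infty$: $\theta\in\mathcal K$ with $\lim_{x\to\infty}\theta(x)=\infty$. $\mathcal L$: continuous strictly decreasing $\gamma:\mathbb R_0^+\to\mathbb R_0^+$ with $\lim_{t\to\infty}\gamma(t)=0$. $\mathcal{KL}$: $\beta:(\mathbb R_0^+)^2\to\mathbb R_0^+$ with $\beta(\cdot,t)\in\mathcal K$ for all $t\ge0$ and $\beta(s,\cdot)\in\mathcal L$ for all $s>0$. Stability notions (here for every $t\ge0$, $x_0\in X$, $u\in L^\infty(0,t;U)$). - $L^\infty$-ISS: there are $\beta\in\mathcal{KL}$, $\mu\in\mathcal K_\infty$ such that $x(t)\in X$ and $\|x(t)\|\le\beta(\|x_0\|,t)+\mu(\|u\|_{L^\infty(0,t;U)})$. - $L^\infty$-iISS: there are $\beta\in\mathcal{KL}$, $\theta\in\mathcal K_\infty$, $\mu\in\mathcal K$ such that $x(t)\in X$ and $\|x(t)\|\le\beta(\|x_0\|,t)+\theta\left(\int_0^t\mu(\|u(s)\|_U)\,ds\right)$. - $\Sigma(A,B)$ is $L^\infty$-admissible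 if $\int_0^tT_{-1}(s)Bu(s)\,ds\in X$ for all $t>0$, $u\in L^\infty(0,t;U)$; then $c(t)$ denotes the smallest constant with $\left\|\int_0^tT_{-1}(s)Bu(s)\,ds\right\|\le c(t)\|u\|_{L^\infty(0,t;U)}$ for all such $u$. It is $L^\infty$-zero-class admissible if it is $L^\infty$-admissible and $\lim_{t\to0}c(t)=0$. *)

(* Defs.v *)
From HB Require Import structures.
From mathcomp Require Import all_boot all_order all_algebra.
From mathcomp Require Import complex.
From mathcomp Require Import all_classical all_reals all_analysis ess_sup_inf.
Import Order.TTheory GRing.Theory Num.Theory.
Import numFieldNormedType.Exports.

Set Implicit Arguments.
Unset Strict Implicit.
Unset Printing Implicit Defensive.

Local Open Scope classical_set_scope.
Local Open Scope ring_scope.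
Local Open Scope complex_scope.

(* The norm of a normed module over R[i] takes its values in R[i]; [rnorm] is
   the same number seen in R. *)
Definition rnorm (R : realType) (V : normedZmodType R[i]) (v : V) : R :=
  complex.Re `|v|.

Definition bounded_linear (R : realType) (V W : normedModType R[i])
    (f : V -> W) : Prop :=
  linear f /\ exists M : R, forall v, rnorm (f v) <= M * rnorm v.

Section Comparison.
Variable R : realType.

(* Comparison functions live on [0, +oo[; their values at negative arguments
   are irrelevant. *)
Definition classK (mu : R -> R) : Prop :=
  [/\ {within `[0, +oo[, continuous mu},
      forall x, 0 <= x -> 0 <= mu x,
      forall x y, 0 <= x -> x < y -> mu x < mu y
    & mu 0 = 0].

Definition classKoo (theta : R -> R) : Prop :=
  classK theta /\ theta x @[x --> +oo] --> +oo.

Definition classL (gamma : R -> R) : Prop :=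
  [/\ {within `[0, +oo[, continuous gamma},
      forall t, 0 <= t -> 0 <= gamma t,
      forall s t, 0 <= s -> s < t -> gamma t < gamma s
    & gamma t @[t --> +oo] --> 0].

Definition classKL (beta : R -> R -> R) : Prop :=
  (forall t, 0 <= t -> classK (beta ^~ t)) /\
  (forall s, 0 < s -> classL (beta s)).

End Comparison.

Section Bochner.
Context {R : realType} {d : measure_display} {T : measurableType d}.
Variables (mu : {measure set T -> \bar R}) (V : normedModType R[i]).
Implicit Types (D : set T) (f : T -> V).

Definition simple_on D f : Prop :=
  [/\ finite_set (range f),
      forall v, measurable (f @^-1` [set v])
    & forall v, v != 0 -> (mu (D `&` f @^-1` [set v]) < +oo)%E].

Definition simple_integral D f : V :=
  \sum_(v \in range f) (fine (mu (D `&` f @^-1` [set v])))%:C *: v.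

Definition strongly_measurable D f : Prop :=
  exists s : nat -> T -> V, (forall n, simple_on D (s n)) /\
    {ae mu, forall x, D x -> s n x @[n --> \oo] --> f x}.

(* f is Bochner integrable on D with integral y *)
Definition is_bochner_integral D f (y : V) : Prop :=
  exists s : nat -> T -> V,
    [/\ forall n, simple_on D (s n),
        {ae mu, forall x, D x -> s n x @[n --> \oo] --> f x},
        (\int[mu]_(x in D) (rnorm (f x - s n x))%:E)%E @[n --> \oo] --> 0%E
      & simple_integral D (s n) @[n --> \oo] --> y].

End Bochner.

Section Input.
Variables (R : realType) (U : normedModType R[i]).

(* The norm is extended by 0 outside [0, t], so that the essential supremum
   is over [0, t], and is 0 for t = 0. *)
Definition Linf_enorm (t : R) (u : R -> U) : \bar R :=
  ess_sup (@lebesgue_measure R)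
    ((fun s => (rnorm (u s))%:E) \_ `[0, t]).

Definition Linf_norm (t : R) (u : R -> U) : R := fine (Linf_enorm t u).

Definition Linf (t : R) (u : R -> U) : Prop :=
  strongly_measurable (@lebesgue_measure R) `[0, t] u /\
  (Linf_enorm t u < +oo)%E.

End Input.

Section Operators.
Variable R : realType.

(* A possibly unbounded operator in X; its values outside its domain are
   irrelevant. *)
Record operator (X : Type) : Type :=
  Operator { dom : set X ; operator_fun :> X -> X }.

Variable X : normedModType R[i].

(* Only the values T t with 0 <= t are meaningful. *)
Definition C0_semigroup (T : R -> X -> X) : Prop :=
  [/\ forall t, 0 <= t -> bounded_linear (T t),
      forall x, T 0 x = x,
      forall s t x, 0 <= s -> 0 <= t -> T (s + t) x = T s (T t x)
    & forall x, T t x @[t --> 0^'+] --> x].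

Definition generates (A : operator X) (T : R -> X -> X) : Prop :=
  let quot x (h : R) : X := (h^-1)%:C *: (T h x - x) in
  (forall x, dom A x <-> cvg (quot x h @[h --> 0^'+])) /\
  (forall x, dom A x -> quot x h @[h --> 0^'+] --> A x).

(* resolvent A beta = (beta - A)^-1 *)
Definition resolvent (A : operator X) (beta : R[i]) (x : X) : X :=
  xget 0 [set y | dom A y /\ beta *: y - A y = x].

Definition resolvent_set (A : operator X) : set R[i] :=
  [set beta | set_bij (dom A) setT (fun y => beta *: y - A y) /\
              bounded_linear (resolvent A beta)].

Definition eigenpair (A : operator X) (lambda : R[i]) (e : X) : Prop :=
  [/\ dom A e, e != 0 & A e = lambda *: e].

Definition schauder_basis (e : nat -> X) : Prop :=
  forall x : X, exists! a : nat -> R[i],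
    series (fun k => a k *: e k) @ \oo --> x.

Definition ell (q : R) (a : nat -> R[i]) : Prop :=
  cvgn (series (fun k => rnorm (a k) `^ q)).

Definition q_riesz_basis (q : R) (e : nat -> X) : Prop :=
  schauder_basis e /\
  exists c1 c2 : R, [/\ 0 < c1, 0 < c2 & forall a, ell q a ->
    let S := limn (series (fun k => rnorm (a k) `^ q)) in
    let v := limn (series (fun k => a k *: e k)) in
    [/\ cvgn (series (fun k => a k *: e k)),
        c1 * S <= rnorm v `^ q & rnorm v `^ q <= c2 * S]].

Definition in_open_left_sector (lambda : nat -> R[i]) : Prop :=
  (forall n, complex.Re (lambda n) < 0) /\
  exists2 k : R, 0 < k & forall n, `|complex.Im (lambda n)| <= k * `|complex.Re (lambda n)|.

End Operators.

Section Extrapolation.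
Variables (R : realType) (X Xm1 : completeNormedModType R[i]).

(* j embeds X in Xm1 as a completion of X for the norm
   x |-> ||(beta - A)^-1 x||. *)
Definition is_extrapolation_space (A : operator X) (beta : R[i])
    (j : X -> Xm1) : Prop :=
  [/\ linear j, forall x, rnorm (j x) = rnorm (resolvent A beta x)
    & dense (range j)].

Definition is_extension (j : X -> Xm1) (T : R -> X -> X)
    (Tm1 : R -> Xm1 -> Xm1) : Prop :=
  C0_semigroup Tm1 /\ forall t x, 0 <= t -> Tm1 t (j x) = j (T t x).

End Extrapolation.

(* The system is given by the semigroup T on X, the embedding j of X in Xm1,
   the extension Tm1 of T to Xm1 and the control operator B. An element z of
   Xm1 belongs to X when z = j y for some y, and then its norm in X is that
   of y. *)
Section Stability.
Variables (R : realType) (X Xm1 : completeNormedModType R[i]).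
Variable U : normedModType R[i].
Variables (T : R -> X -> X) (j : X -> Xm1) (Tm1 : R -> Xm1 -> Xm1).
Variable B : U -> Xm1.

Local Notation leb := (@lebesgue_measure R).

(* z is the value at time t of the mild solution *)
Definition is_mild_solution (x0 : X) (u : R -> U) (t : R) (z : Xm1) : Prop :=
  exists2 w, is_bochner_integral leb `[0, t] (fun s => Tm1 (t - s) (B (u s))) w
    & z = j (T t x0) + w.

Definition Linf_ISS : Prop :=
  exists beta mu, [/\ classKL beta, classKoo mu &
    forall t x0 (u : R -> U), 0 <= t -> Linf t u ->
    exists2 y : X, is_mild_solution x0 u t (j y) &
      rnorm y <= beta (rnorm x0) t + mu (Linf_norm t u)].

Definition Linf_iISS : Prop :=
  exists beta theta mu, [/\ classKL beta, classKoo theta, classK mu &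
    forall t x0 (u : R -> U), 0 <= t -> Linf t u ->
    exists2 y : X, is_mild_solution x0 u t (j y) &
      rnorm y <= beta (rnorm x0) t +
        theta (Rintegral leb `[0, t] (fun s => mu (rnorm (u s))))].

(* y is the integral of s |-> Tm1 s (B (u s)) over [0, t], lying in X *)
Definition is_input_integral (t : R) (u : R -> U) (y : X) : Prop :=
  is_bochner_integral leb `[0, t] (fun s => Tm1 s (B (u s))) (j y).

Definition Linf_admissible : Prop :=
  forall t (u : R -> U), 0 < t -> Linf t u -> exists y, is_input_integral t u y.

Definition admissibility_bound (t c : R) : Prop :=
  forall (u : R -> U) y, Linf t u -> is_input_integral t u y ->
    rnorm y <= c * Linf_norm t u.

Definition Linf_zero_class_admissible : Prop :=
  Linf_admissible /\
  exists c : R -> R,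
    (forall t, 0 < t -> admissibility_bound t (c t) /\
       forall c', admissibility_bound t c' -> c t <= c') /\
    c t @[t --> 0^'+] --> 0.

End Stability.

(* Main.v *)
(* Writing B u = u b, the resolvent maps b to a vector sum_n zeta_n e_n of X,
   so that b = sum_n (beta - lambda_n) zeta_n e_n in the extrapolation space.
   With r_n = - Re lambda_n, the sector condition and the spectral gap give
   |beta - lambda_n| <= C r_n, hence the n-th coordinate of the input integral
   is at most C |zeta_n| times the integral of r_n exp(- r_n rho(s)) |u(s)|.

   Since sum_n |zeta_n|^q < oo, there are kappa_n -> oo for which
   sum_n kappa_n^2 zeta_n e_n still converges. Let mu(v) be v plus the locally
   finite sum of r_n (v - kappa_n)^+. For every d > 0 there is C_d with
     r_n exp(- r_n rho) v <= d kappa_n^2 r_n exp(- r_n rho) + C_d mu(v),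
   so every coordinate is bounded by C |zeta_n| kappa_n^2 (d + C_d I), where I is
   the integral of mu(|u|), and the norm of the input integral by a constant
   times inf_d (d + C_d I), a concave function of I that vanishes at 0. The same
   weights give the Linf bound and its decay as t -> 0.

   Coordinatewise bounds pass to norms because, by the q-Riesz inequalities,
   ||sum m_n a_n e_n|| <= K sup |m_n| ||sum a_n e_n||. *)

Require Import Defs.
From mathcomp Require Import all_boot all_order all_algebra.
From mathcomp Require Import complex finmap.
From mathcomp Require Import all_classical all_reals all_analysis.
From mathcomp Require Import measurable_realfun ess_sup_inf.
From mathcomp Require Import lra ring.
Import Order.TTheory GRing.Theory Num.Theory.
Import numFieldNormedType.Exports.

Set Implicit Arguments.
Unset Strict Implicit.
Unset Printing Implicit Defensive.

Local Open Scope classical_set_scope.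
Local Open Scope ring_scope.
Local Open Scope complex_scope.

(** * Real-valued norms *)

(** The orbit of b has an expansion that need converge only in the extrapolation space, so the input
    integral cannot be formed in X directly. It is approached by two limits: cutting the expansion
    after M modes gives integrals in X, and replacing input and time by simple functions turns these
    into finite sums. On finite sums the coordinates are explicit, so the Riesz inequalities apply
    without any coordinate functional. The truncated integrals are then Cauchy in X, and uniform
    convergence of the truncated orbits in the extrapolation space identifies their limit.

    The weight is kappa_n^2 while mu uses kappa_n: if v > d kappa_n^2 and v is large, then kappa_n <
    sqrt(v / d) <= v / 2, so a fixed share of r_n v occurs in mu(v). With the same power in both
    places the term r_n (v - kappa_n)^+ could vanish.

    For small t, the modes with d kappa_n^2 >= 1 are controlled by the weight alone; the others have
    r_n bounded in terms of d, and their contribution carries a factor t. *)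

Section RealNorm.
Variables (R : realType).

Lemma rnormE (V : normedZmodType R[i]) (v : V) : `|v| = (rnorm v)%:C.
Proof. by rewrite /rnorm RRe_real// normr_real. Qed.

Lemma rnorm_ge0 (V : normedZmodType R[i]) (v : V) : 0 <= rnorm v.
Proof. by rewrite -ler0c -rnormE. Qed.

Lemma rnorm0 (V : normedZmodType R[i]) : rnorm (0 : V) = 0.
Proof. by rewrite /rnorm normr0. Qed.

Lemma rnorm_eq0 (V : normedZmodType R[i]) (v : V) : (rnorm v == 0) = (v == 0).
Proof.
by rewrite -[RHS]normr_eq0 rnormE -(inj_eq (@complexI R)).
Qed.

Lemma rnormN (V : normedZmodType R[i]) (v : V) : rnorm (- v) = rnorm v.
Proof. by rewrite /rnorm normrN. Qed.

Lemma rnormB (V : normedZmodType R[i]) (v w : V) : rnorm (v - w) = rnorm (w - v).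
Proof. by rewrite /rnorm distrC. Qed.

Lemma ler_rnormD (V : normedZmodType R[i]) (v w : V) :
  rnorm (v + w) <= rnorm v + rnorm w.
Proof. by rewrite -lecR rmorphD/= -!rnormE ler_normD. Qed.

Lemma ler_rnormB (V : normedZmodType R[i]) (v w : V) :
  rnorm (v - w) <= rnorm v + rnorm w.
Proof. by rewrite -(rnormN w) ler_rnormD. Qed.

Lemma ler_rdistD (V : normedZmodType R[i]) (u v w : V) :
  rnorm (v - w) <= rnorm (v - u) + rnorm (u - w).
Proof. by rewrite (le_trans _ (ler_rnormD _ _))// addrA subrK. Qed.

Lemma lerB_rdist (V : normedZmodType R[i]) (v w : V) :
  `|rnorm v - rnorm w| <= rnorm (v - w).
Proof.
have := ler_rdistD w v 0; have := ler_rdistD v w 0.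
by rewrite !subr0 (rnormB w v) ler_norml => h1 h2; apply/andP; split; lra.
Qed.

Lemma ler_rnorm_sum (V : normedZmodType R[i]) (I : Type) (r : seq I)
  (P : pred I) (F : I -> V) :
  rnorm (\sum_(i <- r | P i) F i) <= \sum_(i <- r | P i) rnorm (F i).
Proof.
elim/big_ind2 : _ => // [|x x' y y' h h']; first by rewrite rnorm0.
by rewrite (le_trans (ler_rnormD _ _)) ?lerD.
Qed.

Lemma rnormZ (V : normedModType R[i]) (a : R[i]) (v : V) :
  rnorm (a *: v) = rnorm a * rnorm v.
Proof. by rewrite {1}/rnorm normrZ !rnormE /= !mul0r subr0. Qed.

Lemma rnormM (a b : R[i]) : rnorm (a * b) = rnorm a * rnorm b.
Proof. by apply: complexI; rewrite rmorphM -!rnormE normrM. Qed.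

Lemma rnormc (a : R[i]) : rnorm a = Num.sqrt (complex.Re a ^+ 2 + complex.Im a ^+ 2).
Proof. by rewrite /rnorm normc_def. Qed.

Lemma rnormc_real (r : R) : rnorm r%:C = `|r|.
Proof. by rewrite rnormc/= expr0n addr0 sqrtr_sqr. Qed.

Lemma rnorm1 : rnorm (1 : R[i]) = 1.
Proof. by rewrite (rnormc_real 1) normr1. Qed.

Lemma rnormZr (V : normedModType R[i]) (a : R) (v : V) :
  rnorm (a%:C *: v) = `|a| * rnorm v.
Proof. by rewrite rnormZ rnormc_real. Qed.

Lemma rnormc_le (a : R[i]) : rnorm a <= `|complex.Re a| + `|complex.Im a|.
Proof.
rewrite [a in rnorm a]complexE (le_trans (ler_rnormD _ _))// rnormM !rnormc_real.
by rewrite (_ : rnorm 'i%C = 1) ?mul1r// rnormc /= expr0n add0r expr1n sqrtr1.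
Qed.

Lemma cvg_rnormP (V : normedModType R[i]) (T : Type) (F : set_system T)
  {FF : Filter F} (f : T -> V) (l : V) :
  f @ F --> l <-> rnorm (f x - l) @[x --> F] --> (0 : R).
Proof.
split.
  move=> /cvgrPdist_lt h; apply/cvgrPdist_lt => e e0.
  have := h e%:C; rewrite ltcR => /(_ e0); apply: filterS => x.
  by rewrite rnormE ltcR sub0r normrN ger0_norm ?rnorm_ge0// rnormB.
move=> /cvgrPdist_lt h; apply/cvgrPdist_lt => e e0.
have er : e = (complex.Re e)%:C by rewrite RRe_real// gtr0_real.
rewrite er in e0 *; rewrite ltcR in e0.
have := h _ e0; apply: filterS => x.
by rewrite rnormE ltcR sub0r normrN ger0_norm ?rnorm_ge0// rnormB.
Qed.

Lemma cvg_rnorm (V : normedModType R[i]) (T : Type) (F : set_system T)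
  {FF : Filter F} (f : T -> V) (l : V) :
  f @ F --> l -> rnorm (f x) @[x --> F] --> rnorm l.
Proof.
move=> /cvg_rnormP fl; apply/cvgrPdist_lt => e e0.
move/cvgrPdist_lt : fl => /(_ e e0); apply: filterS => x.
rewrite sub0r normrN ger0_norm ?rnorm_ge0//; apply: le_lt_trans.
by rewrite (le_trans (lerB_rdist _ _))// rnormB.
Qed.

Lemma squeeze_rnorm (V : normedModType R[i]) (T : Type) (F : set_system T)
  {FF : Filter F} (f : T -> V) (l : V) (g : T -> R) :
  (\forall x \near F, rnorm (f x - l) <= g x) ->
  g x @[x --> F] --> (0 : R) -> f @ F --> l.
Proof.
move=> fg g0; apply/cvg_rnormP; apply: (squeeze_cvgr _ (cvg_cst 0) g0).
by apply: filterS fg => x ->; rewrite rnorm_ge0.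
Qed.

Lemma rnorm_cauchy_cvg (V : completeNormedModType R[i]) (x : nat -> V) :
  (forall e : R, 0 < e -> exists N, forall m n, (N <= m)%N -> (N <= n)%N ->
     rnorm (x m - x n) < e) -> cvgn x.
Proof.
move=> h; apply: cauchy_cvg; apply/cauchy_ballP => e e0.
have er : e = (complex.Re e)%:C by rewrite RRe_real// gtr0_real.
rewrite er in e0 *; rewrite ltcR in e0.
have [N hN] := h _ e0.
exists (x @` [set n | (N <= n)%N], x @` [set n | (N <= n)%N]) => /=.
  by split; exists N => // n /= Nn; exists n.
by move=> [_ _] /= [[m Nm <-] [n Nn <-]]; rewrite -ball_normE/= rnormE ltcR hN.
Qed.

Lemma cvg0_near (T : Type) (F : set_system T) {FF : Filter F} (g : T -> R) (e : R) :
  g x @[x --> F] --> 0 -> 0 < e -> \forall x \near F, `|g x| < e.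
Proof.
by move=> /cvgrPdist_lt h e0; have := h e e0; apply: filterS => x; rewrite sub0r normrN.
Qed.

Lemma cvg0_nat (g : nat -> R) (e : R) :
  g n @[n --> \oo] --> 0 -> 0 < e -> exists N, forall n, (N <= n)%N -> `|g n| < e.
Proof. by move=> h /(cvg0_near h)[N _ hN]; exists N => n /hN. Qed.

Lemma cvg_le_bound (T : Type) (F : set_system T) {FF : ProperFilter F} (g : T -> R)
  (l b : R) : g x @[x --> F] --> l -> (\forall x \near F, g x <= b) -> l <= b.
Proof.
move=> gl gb; rewrite -(cvg_lim _ gl)//; apply: limr_le => //.
by apply/cvg_ex; exists l.
Qed.

Lemma cvg_ge_bound (T : Type) (F : set_system T) {FF : ProperFilter F} (g : T -> R)
  (l b : R) : g x @[x --> F] --> l -> (\forall x \near F, b <= g x) -> b <= l.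
Proof.
move=> gl gb; rewrite -(cvg_lim _ gl)//; apply: limr_ge => //.
by apply/cvg_ex; exists l.
Qed.

Lemma cvg_rnorm_bounded (V : normedModType R[i]) (x : nat -> V) : cvgn x ->
  exists2 M : R, 0 < M & forall n, rnorm (x n) <= M.
Proof.
move=> /cvg_ex[l /cvg_rnorm xl].
have cx : cvgn (fun n => rnorm (x n)) by apply/cvg_ex; exists (rnorm l).
have /pinfty_ex_gt0[M M0 hM] := cvg_seq_bounded cx.
by exists M => // n; have := hM n I; rewrite /= ger0_norm ?rnorm_ge0.
Qed.

Lemma cvge_lt_near (u : nat -> \bar R) (l c : \bar R) :
  u n @[n --> \oo] --> l -> (l < c)%E -> exists N, forall n, (N <= n)%N -> (u n < c)%E.
Proof.
move=> ul lc; have /ul[N _ hN] : nbhs l [set x | (x < c)%E].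
  apply: open_nbhs_nbhs; split; last exact: lc.
  exact: open_ereal_lt_ereal.
by exists N => n /hN.
Qed.

Lemma linearfB (V W : normedModType R[i]) (f : V -> W) x y :
  linear f -> f (x - y) = f x - f y.
Proof. by move=> /(_ (-1) y x); rewrite !scaleN1r [x - y]addrC [RHS]addrC. Qed.

Lemma linearfD (V W : normedModType R[i]) (f : V -> W) x y :
  linear f -> f (x + y) = f x + f y.
Proof. by move=> /(_ 1 x y); rewrite !scale1r. Qed.

Lemma linearf0 (V W : normedModType R[i]) (f : V -> W) :
  linear f -> f 0 = 0.
Proof. by move=> /(_ (-1) 0 0); rewrite scaler0 addr0 scaleN1r addNr. Qed.

Lemma linearfZ (V W : normedModType R[i]) (f : V -> W) a x :
  linear f -> f (a *: x) = a *: f x.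
Proof. by move=> lf; rewrite -[a *: x]addr0 lf linearf0// addr0. Qed.

Lemma linearf_sum (V W : normedModType R[i]) (f : V -> W) (I : Type) (r : seq I)
  (P : pred I) (F : I -> V) :
  linear f -> f (\sum_(i <- r | P i) F i) = \sum_(i <- r | P i) f (F i).
Proof.
move=> lf; elim/big_rec2 : _ => [|i x y _ <-]; first exact: linearf0.
by rewrite linearfD.
Qed.

End RealNorm.

(** * Local boundedness of semigroups *)

Section LocalBound.
Variables (R : realType).

(** The least admissible constant, an infimum, serves as operator norm. It is positive, since
    otherwise [f] would vanish and [K] would be a bound; hence 3/4 of it is not a bound. The factor
    3/4 exceeds the 1/2 that the tail costs in the gliding hump. *)
Lemma opnorm_almost_attained (V W : normedModType R[i]) (f : V -> W) (K : R) :
  bounded_linear f -> 0 <= K -> ~ (forall x, rnorm (f x) <= K * rnorm x) ->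
  exists N, [/\ K <= N, forall x, rnorm (f x) <= N * rnorm x &
    exists x, rnorm x = 1 /\ 3 / 4 * N < rnorm (f x)].
Proof.
move=> [lf [M fM]] K0 nK.
pose S := [set N | 0 <= N /\ forall x, rnorm (f x) <= N * rnorm x].
have lbS : has_inf S.
  split; last by exists 0 => N [].
  exists `|M|; split => // x.
  by rewrite (le_trans (fM x))// ler_wpM2r ?rnorm_ge0// ler_norm.
have KN : K <= inf S.
  apply: lb_le_inf; first exact: lbS.1.
  move=> N [N0 fN]; rewrite leNgt; apply/negP => NK.
  by apply: nK => x; rewrite (le_trans (fN x))// ler_wpM2r ?rnorm_ge0// ltW.
have fN x : rnorm (f x) <= inf S * rnorm x.
  have [->|x0] := eqVneq x 0; first by rewrite linearf0// !rnorm0 mulr0.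
  have x0' : 0 < rnorm x by rewrite lt_def rnorm_eq0 x0 rnorm_ge0.
  rewrite -ler_pdivrMr//; apply: lb_le_inf; first exact: lbS.1.
  by move=> N [_ fN]; rewrite ler_pdivrMr.
exists (inf S); split => //.
have N0 : 0 < inf S.
  rewrite lt_neqAle (le_trans K0 KN) andbT; apply/eqP => S0.
  apply: nK => x; rewrite (le_trans (fN x))// -S0 mul0r.
  by rewrite mulr_ge0 ?rnorm_ge0.
have [x fx] : exists x, 3 / 4 * inf S * rnorm x < rnorm (f x).
  apply: contrapT => /forallNP h.
  have : inf S <= 3 / 4 * inf S.
    apply: ge_inf; first exact: lbS.2.
    split; first by rewrite mulr_ge0// ltW.
    by move=> x; rewrite leNgt; apply/negP.
  lra.
have x0 : x != 0.
  by apply: contraPneq fx => ->; rewrite linearf0// !rnorm0 mulr0 ltxx.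
have x0' : 0 < rnorm x by rewrite lt_def rnorm_eq0 x0 rnorm_ge0.
exists (((rnorm x)^-1)%:C *: x); rewrite linearfZ// !rnormZr.
rewrite ger0_norm ?invr_ge0 ?rnorm_ge0// mulVf ?gt_eqF//; split => //.
by rewrite -ltr_pdivrMl ?invr_gt0// invrK mulrC.
Qed.

(* Sokal's gliding hump: one of [T (x + xi)] and [T (x - xi)] is at least
   [T xi], so a vector whose images are unbounded is built by adding the almost
   norming vectors of size [3 ^- n] with suitable signs. *)
Lemma uniform_boundedness_seq (V W : completeNormedModType R[i])
    (f : nat -> V -> W) :
  (forall n, bounded_linear (f n)) ->
  (forall n, exists N, [/\ 4 ^+ n <= N, forall x, rnorm (f n x) <= N * rnorm x &
    exists x, rnorm x = 1 /\ 3 / 4 * N < rnorm (f n x)]) ->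
  exists x, forall n, 4^-1 * (4 / 3) ^+ n <= rnorm (f n x).
Proof.
move=> lf /choice[N hN].
have /choice[xi hxi] : forall n, exists x, rnorm x = 1 /\ 3 / 4 * N n < rnorm (f n x).
  by move=> n; have [] := hN n.
pose h n := ((3 ^- n : R)%:C) *: xi n.
have rh n : rnorm (h n) = 3 ^- n.
  by rewrite rnormZr (hxi n).1 mulr1 ger0_norm// invr_ge0 exprn_ge0.
pose next n x := if rnorm (f n (h n)) <= rnorm (f n (x + h n)) then x + h n else x - h n.
have nextP n x : rnorm (f n (h n)) <= rnorm (f n (next n x)).
  rewrite /next; case: ifPn => //; rewrite -ltNge => hlt.
  rewrite leNgt; apply/negP => hlt'.
  have : rnorm (f n (x + h n) - f n (x - h n)) < rnorm (f n (h n)) + rnorm (f n (h n)).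
    by rewrite (le_lt_trans (ler_rnormB _ _))// ltrD.
  rewrite -linearfB; last exact: (lf n).1.
  rewrite (_ : _ - _ = h n + h n); last by rewrite opprB addrC addrA subrK.
  rewrite linearfD; last exact: (lf n).1.
  rewrite -mulr2n -scaler_nat rnormZ.
  have -> : rnorm (2%:R : R[i]) = 2.
    by rewrite -(rmorph_nat (real_complex R)) rnormc_real ger0_norm.
  by rewrite mulr_natl mulr2n ltxx.
have nextd n x : rnorm (next n x - x) = 3 ^- n.
  by rewrite /next; case: ifP => _; rewrite addrAC subrr add0r ?rnormN rh.
pose x := fix x n := if n is m.+1 then next m (x m) else 0.
have xd n k : rnorm (x (n + k)%N - x n) <= 3 / 2 * (3 ^- n - 3 ^- (n + k)).
  elim: k => [|k ih]; first by rewrite addn0 !subrr rnorm0 mulr0.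
  rewrite addnS /= (le_trans (ler_rdistD (x (n + k)%N) _ _))// nextd.
  rewrite (le_trans (lerD (lexx _) ih))// exprS invfM.
  move=> {ih}; have : 0 <= (3 ^- (n + k) : R) by rewrite invr_ge0 exprn_ge0.
  lra.
have xd' n m : (n <= m)%N -> rnorm (x m - x n) <= 3 / 2 * 3 ^- n.
  move=> nm; rewrite -(subnKC nm) (le_trans (xd _ _))// ler_wpM2l//.
  by rewrite gerBl invr_ge0 exprn_ge0.
have g0 : (3 / 2 * 3 ^- n : R) @[n --> \oo] --> (0 : R).
  rewrite -(mulr0 (3 / 2)); apply: cvgMr.
  under eq_fun do rewrite -exprVn.
  by apply: cvg_expr; rewrite ger0_norm ?invr_ge0// invf_lt1// ltr1n.
have cx : cvgn x.
  apply: rnorm_cauchy_cvg => e e0.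
  have e20 : 0 < e / 2 by lra.
  have [M hM] := cvg0_nat g0 e20.
  exists M => m n Mm Mn.
  have hM' := hM M (leqnn _).
  rewrite (le_lt_trans (ler_rdistD (x M) _ _))// (rnormB (x M)).
  rewrite (splitr e) ltrD// (le_lt_trans (xd' _ _ _))//;
    exact: (le_lt_trans (ler_norm _)).
exists (limn x) => n.
have xl : rnorm (limn x - x n.+1) <= 3 / 2 * 3 ^- n.+1.
  have hlim : rnorm (x m - x n.+1) @[m --> \oo] --> rnorm (limn x - x n.+1).
    by apply: cvg_rnorm; apply: cvgB => //; exact: cvg_cst.
  apply: (cvg_le_bound hlim); exists n.+1 => // m; exact: xd'.
have [KN fN _] := hN n; have [_ fxi] := hxi n.
have h1 := nextP n (x n); rewrite -/(x n.+1) in h1.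
have h2 : rnorm (f n (x n.+1)) <= rnorm (f n (limn x)) + N n * (3 / 2 * 3 ^- n.+1).
  have N0 : 0 <= N n by rewrite (le_trans _ KN)// exprn_ge0.
  rewrite -[x n.+1](subrK (limn x)) addrC linearfD; last exact: (lf n).1.
  rewrite (le_trans (ler_rnormD _ _))// lerD2l (le_trans (fN _))// ler_wpM2l//.
  by rewrite rnormB.
have h3 : 3 / 4 * N n * 3 ^- n <= rnorm (f n (h n)).
  rewrite linearfZ; last exact: (lf n).1.
  rewrite rnormZr ger0_norm ?invr_ge0 ?exprn_ge0// mulrC ler_wpM2l ?invr_ge0 ?exprn_ge0//.
  exact: ltW.
have h4 : 4^-1 * (4 / 3) ^+ n <= 4^-1 * (N n * 3 ^- n).
  by rewrite ler_wpM2l// exprMn exprVn ler_wpM2r// invr_ge0 exprn_ge0.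
(* From the hump 3/4 N 3^-n the tail removes at most N (3/2) 3^-(n+1) = 1/2 N 3^-n. The remaining
   quarter suffices because N >= 4^n. *)
rewrite (le_trans h4)//; move: h1 h2 h3; rewrite exprS invfM; lra.
Qed.

(** If no 4^n bounded the semigroup on [0, 1/(n+1)], there would be times t_n tending to 0 at which
    4^n fails. The gliding hump then yields one [x] with [T (t n) x] unbounded, against the right
    continuity of its orbit at 0. *)
Lemma C0_locally_bounded (X : completeNormedModType R[i]) (T : R -> X -> X) :
  C0_semigroup T ->
  exists d M, [/\ 0 < d, 1 <= M &
    forall t x, 0 <= t -> t <= d -> rnorm (T t x) <= M * rnorm x].
Proof.
move=> [bT T0 TD Tc].
have [n hn] : exists n : nat, forall t, 0 <= t -> t <= n.+1%:R^-1 ->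
    forall x, rnorm (T t x) <= 4 ^+ n * rnorm x.
  apply: contrapT => /forallNP nh.
  have /choice[t ht] : forall n : nat, exists t : R,
     [/\ 0 <= t, t <= n.+1%:R^-1 & ~ forall x, rnorm (T t x) <= 4 ^+ n * rnorm x].
    move=> n; apply: contrapT => h; apply: (nh n) => t t0 tn.
    by apply: contrapT => h'; apply: h; exists t.
  have [|n|x hx] := @uniform_boundedness_seq X X (fun n => T (t n)).
  - by move=> n; apply: bT; have [] := ht n.
  - have [t0 _ nK] := ht n.
    by apply: opnorm_almost_attained; [exact: bT | exact: exprn_ge0 | exact: nK].
  have [d /= d0 hd] := cvg0_near ((cvg_rnormP _ _).1 (Tc x)) ltr01.
  have te : t n @[n --> \oo] --> (0 : R).
    apply: (squeeze_cvgr _ (cvg_cst 0) (@cvg_harmonic R)).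
    by apply: nearW => n; have [-> ->] := ht n.
  (* Bernoulli's inequality makes the index explicit: n > 12 (|x| + 2) forces (4/3)^n / 4 > |x| +
     2. *)
  have bern n : 1 + n%:R / 3 <= (4 / 3 : R) ^+ n.
    elim: n => [|n ih]; first by rewrite mul0r addr0 expr0.
    have n0 : 0 <= n%:R :> R by [].
    by rewrite exprS -natr1; move: ih; set a := _ ^+ n; lra.
  have [N1 h1] := cvg0_nat te d0.
  have [N2 h2] : exists N2 : nat, 4 * (rnorm x + 2) < (4 / 3) ^+ (maxn N1 N2).
    exists (Num.truncn (12 * (rnorm x + 2))).+1.
    have := bern (maxn N1 (Num.truncn (12 * (rnorm x + 2))).+1).
    have := truncnS_gt (12 * (rnorm x + 2)).
    have : ((Num.truncn (12 * (rnorm x + 2))).+1%:R : R) <=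
       (maxn N1 (Num.truncn (12 * (rnorm x + 2))).+1)%:R by rewrite ler_nat leq_maxr.
    set a := _ ^+ _; set b : R := _%:R; set c : R := _%:R; set r := rnorm x.
    lra.
  have := h1 _ (leq_maxl N1 N2); move: (maxn _ _) h2 => n h3 hh.
  have h4 := hx n.
  have h5 : 2 + rnorm x < rnorm (T (t n) x).
    by move: h3 h4; set a := _ ^+ _; set b := rnorm _; set c := rnorm _; clear; lra.
  have [t0 _ nK] := ht n.
  (* The right limit at 0 says nothing about [t n = 0], where [T 0 x = x] contradicts the lower
     bound at once. *)
  have [t00|t00] := eqVneq (t n) 0.
    by move: h5; rewrite t00 T0; clear; lra.
  have := hd (t n); rewrite /ball/= sub0r normrN.
  move=> /(_ hh); rewrite lt_def t00 t0 => /(_ isT).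
  rewrite ger0_norm ?rnorm_ge0// => h6.
  have := lerB_rdist (T (t n) x) x; rewrite ler_norml => /andP[_]; move: h5 h6; clear; lra.
exists n.+1%:R^-1, (4 ^+ n); split => //; first by rewrite exprn_ege1// ler1n.
by move=> t x t0 tn; apply: hn.
Qed.

Lemma C0_bounded_on_compact (X : completeNormedModType R[i]) (T : R -> X -> X) (t : R) :
  C0_semigroup T ->
  exists2 M, 1 <= M &
    forall s x, 0 <= s -> s <= t -> rnorm (T s x) <= M * rnorm x.
Proof.
move=> hT; have [d [M [d0 M1 hM]]] := C0_locally_bounded hT.
case: hT => bT T0 TD Tc.
have M0 : 0 <= M by lra.
have hk (k : nat) : forall s x, 0 <= s -> s <= k%:R * d -> rnorm (T s x) <= M ^+ k * rnorm x.
  elim: k => [|k ih] s x s0 sk.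
    have -> : s = 0 by apply/eqP; rewrite eq_le s0 andbT; rewrite mul0r in sk.
    by rewrite T0 mul1r.
  have [sk'|sk'] := leP s (k%:R * d).
    by rewrite (le_trans (ih _ _ s0 sk'))// ler_wpM2r ?rnorm_ge0// ler_weXn2l// leqnSn.
  have kd : 0 <= k%:R * d by rewrite mulr_ge0// ltW.
  have -> : s = (s - k%:R * d) + k%:R * d by ring.
  rewrite TD//; last by lra.
  rewrite (le_trans (hM _ _ _ _))//; first by lra.
    by move: sk; rewrite -natr1 mulrDl; lra.
  by rewrite exprS -mulrA ler_wpM2l// ih.
exists (M ^+ (Num.truncn (t / d)).+1); first by rewrite exprn_ege1.
move=> s x s0 st; apply: hk => //.
rewrite (le_trans st)// -ler_pdivrMr// ltW//.
exact: truncnS_gt.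
Qed.

End LocalBound.

(** * Eigenvectors of the generator *)

Section Exponential.
Variables (R : realType).

(** This is exp(l t), split into real and imaginary parts so that modulus, continuity and derivative
    reduce to the real exponential, cosine and sine. *)
Definition cexpt (l : R[i]) (t : R) : R[i] :=
  let: a +i* b := l in
  (expR (a * t) * cos (b * t)) +i* (expR (a * t) * sin (b * t)).

Lemma cexpt0 l : cexpt l 0 = 1.
Proof. by case: l => a b; rewrite /cexpt !mulr0 expR0 cos0 sin0 mulr1 mulr0. Qed.

Lemma cexptD l s t : cexpt l (s + t) = cexpt l s * cexpt l t.
Proof.
case: l => a b; rewrite /cexpt !mulrDr expRD cosD sinD; apply/eqP.
by rewrite eq_complex /=; apply/andP; split; apply/eqP; ring.
Qed.

Lemma rnorm_cexpt l t : rnorm (cexpt l t) = expR (complex.Re l * t).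
Proof.
case: l => a b; rewrite rnormc /cexpt /= !exprMn -mulrDr cos2Dsin2 mulr1.
by rewrite sqrtr_sqr ger0_norm// expR_ge0.
Qed.

Lemma cvg_rnorm_ReIm (T : Type) (F : set_system T) {FF : Filter F}
  (f : T -> R[i]) (l : R[i]) :
  complex.Re (f x) @[x --> F] --> complex.Re l ->
  complex.Im (f x) @[x --> F] --> complex.Im l ->
  rnorm (f x - l) @[x --> F] --> (0 : R).
Proof.
move=> fr fi.
have h : `|complex.Re (f x) - complex.Re l| + `|complex.Im (f x) - complex.Im l|
     @[x --> F] --> (0 : R).
  rewrite -[0 in X in _ --> X](addr0 0); apply: cvgD.
    have : complex.Re (f x) - complex.Re l @[x --> F] --> (0 : R).
      by rewrite -(subrr (complex.Re l)); apply: cvgB => //; exact: cvg_cst.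
    by move=> /(cvg_norm); rewrite normr0.
  have : complex.Im (f x) - complex.Im l @[x --> F] --> (0 : R).
    by rewrite -(subrr (complex.Im l)); apply: cvgB => //; exact: cvg_cst.
  by move=> /(cvg_norm); rewrite normr0.
apply: (squeeze_cvgr _ (cvg_cst 0) h); apply: nearW => x.
rewrite rnorm_ge0/= (le_trans (rnormc_le _))//.
by case: (f x) => ? ?; case: (l) => ? ?.
Qed.

Lemma cexpt_continuous l (t : R) : rnorm (cexpt l s - cexpt l t) @[s --> t] --> (0 : R).
Proof.
have ct (a : R) : {for t, continuous (fun s => a * s : R)}.
  by apply: cvgMl_tmp.
apply: cvg_rnorm_ReIm; case: l => a b /=; apply: cvgM.
- by apply: (@continuous_comp _ _ _ ( *%R a) expR); [exact: ct | exact: continuous_expR].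
- by apply: (@continuous_comp _ _ _ ( *%R b) cos); [exact: ct | exact: continuous_cos].
- by apply: (@continuous_comp _ _ _ ( *%R a) expR); [exact: ct | exact: continuous_expR].
- by apply: (@continuous_comp _ _ _ ( *%R b) sin); [exact: ct | exact: continuous_sin].
Qed.

Lemma is_derive_right_quotient (f : R -> R) (d : R) : is_derive (0 : R) (1 : R) f d ->
  h^-1 * (f h - f 0) @[h --> 0^'+] --> d.
Proof.
move=> [df <-]; apply: cvg_dnbhs_at_right.
suff -> : (fun h => h^-1 * (f h - f 0)) =
    (fun h => h^-1 *: ((f \o shift 0) (h *: (1 : R)) - f 0)) by exact: df.
by apply/funext => h /=; rewrite addr0 [h *: 1]mulr1.
Qed.

Lemma cexpt_right_derivative (l : R[i]) :
  rnorm ((h^-1)%:C * (cexpt l h - 1) - l) @[h --> 0^'+] --> (0 : R).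
Proof.
have dl (a : R) : is_derive (0 : R) (1 : R) (fun t => a * t) a.
  by have := is_deriveZ a (is_derive_id (0 : R) (1 : R)); rewrite [a *: _]mulr1.
have dlc (f : R -> R) (a d : R) : is_derive (a * 0) (1 : R) f d ->
    is_derive (0 : R) (1 : R) (fun t => f (a * t)) (d * a).
  by move=> df; exact: (@is_derive1_comp R f _ _ _ _ df (dl a)).
have de (a : R) : is_derive (0 : R) (1 : R) (fun t => expR (a * t)) a.
  by have := dlc _ a _ (is_derive_expR (a * 0)); rewrite mulr0 expR0 mul1r.
have dc (b : R) : is_derive (0 : R) (1 : R) (fun t => cos (b * t)) 0.
  by have := dlc _ b _ (is_derive_cos (b * 0)); rewrite mulr0 sin0 oppr0 mul0r.
have ds (b : R) : is_derive (0 : R) (1 : R) (fun t => sin (b * t)) b.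
  by have := dlc _ b _ (is_derive_sin (b * 0)); rewrite mulr0 cos0 mul1r.
rewrite -(cexpt0 l); apply: cvg_rnorm_ReIm; case: l => a b /=.
  under eq_fun do rewrite mul0r subr0.
  apply: (@is_derive_right_quotient (fun t => expR (a * t) * cos (b * t))).
  apply: (@is_derive_eq _ _ _ _ _ _ _ _ (is_deriveM (de a) (dc b))).
  by rewrite !mulr0 cos0 scaler0 add0r scale1r.
under eq_fun do rewrite mul0r addr0.
apply: (@is_derive_right_quotient (fun t => expR (a * t) * sin (b * t))).
apply: (@is_derive_eq _ _ _ _ _ _ _ _ (is_deriveM (de a) (ds b))).
by rewrite !mulr0 expR0 sin0 scale0r addr0 scale1r.
Qed.

(* The telescoping sum [T(kh) e - c^k e = sum_i T(ih) (T(h) e - c e) c^(k-1-i)],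
   with [c = e^(l h)] and [h = t / k], has [k] terms of size [o(t / k)]. *)
Lemma semigroup_eigenvector (X : completeNormedModType R[i]) (T : R -> X -> X)
    (A : operator X) (l : R[i]) (e : X) (t : R) :
  C0_semigroup T -> generates A T -> eigenpair A l e -> complex.Re l < 0 -> 0 <= t ->
  T t e = cexpt l t *: e.
Proof.
move=> hT [_ gA] [de _ Ae] l0 t0.
have [M M1 hM] := C0_bounded_on_compact t hT.
case: hT => bT T0 TD _.
have M0 : 0 < M by lra.
(* [T h e] and [cexpt l h *: e] have the same right derivative [l *: e] at 0, so they differ by
   o(h). *)
have step : forall eps : R, 0 < eps -> exists2 d, 0 < d &
    forall h, 0 < h -> h < d -> rnorm (T h e - cexpt l h *: e) <= eps * h.
  move=> eps eps0.
  have /cvg_rnormP h1 := gA _ de; rewrite Ae in h1.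
  have e20 : 0 < eps / 2 by lra.
  have e2n : 0 < eps / 2 / (rnorm e + 1) by rewrite divr_gt0// ltr_wpDl// rnorm_ge0.
  have [d1 /= d10 hd1] := cvg0_near h1 e20.
  have [d2 /= d20 hd2] := cvg0_near (cexpt_right_derivative l) e2n.
  exists (Num.min d1 d2); first by rewrite lt_min d10.
  move=> h h0; rewrite lt_min => /andP[hlt1 hlt2].
  have hb d : h < d -> `|0 - h| < d.
    by rewrite sub0r normrN gtr0_norm.
  have := hd1 h (hb _ hlt1) h0; have := hd2 h (hb _ hlt2) h0.
  rewrite /= !ger0_norm ?rnorm_ge0// => k2 k1.
  rewrite -ler_pdivrMr// mulrC -[h^-1]gtr0_norm ?invr_gt0// -rnormZr.
  have -> : (h^-1)%:C *: (T h e - cexpt l h *: e) = ((h^-1)%:C *: (T h e - e) - l *: e)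
      - ((h^-1)%:C * (cexpt l h - 1) - l) *: e.
    rewrite [in RHS]scalerBl opprB addrA subrK -scalerA -scalerBr scalerBl scale1r.
    by rewrite opprB addrA subrK.
  rewrite (le_trans (ler_rnormB _ _))// rnormZ (splitr eps) lerD//; first exact: ltW.
  rewrite (@le_trans _ _ (eps / 2 / (rnorm e + 1) * rnorm e))//.
    by rewrite ler_wpM2r ?rnorm_ge0// ltW.
  by rewrite -mulrA ger_pMr// mulrC ler_pdivrMr ?mul1r ?lerDl// ltr_wpDl ?rnorm_ge0.
have cle s : 0 <= s -> rnorm (cexpt l s) <= 1.
  by move=> s0; rewrite rnorm_cexpt -expR0 ler_expR mulr_le0_ge0// ltW.
have tel (k : nat) h : 0 <= h -> k%:R * h <= t ->
    rnorm (T (k%:R * h) e - cexpt l (k%:R * h) *: e) <=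
    k%:R * (M * rnorm (T h e - cexpt l h *: e)).
  move=> h0; elim: k => [|k ih] kt.
    by rewrite !mul0r T0 cexpt0 scale1r subrr rnorm0.
  have kh0 : 0 <= k%:R * h by rewrite mulr_ge0.
  have kt' : k%:R * h <= t.
    by rewrite (le_trans _ kt)// ler_wpM2r// ler_nat.
  have -> : k.+1%:R * h = k%:R * h + h by rewrite -natr1 mulrDl mul1r.
  rewrite TD// cexptD.
  have -> : T (k%:R * h) (T h e) - (cexpt l (k%:R * h) * cexpt l h) *: e =
     T (k%:R * h) (T h e - cexpt l h *: e) +
     cexpt l h *: (T (k%:R * h) e - cexpt l (k%:R * h) *: e).
    have [lT _] := bT _ kh0.
    rewrite (linearfB _ _ lT) (linearfZ _ _ lT) scalerBr addrA subrK.
    by rewrite scalerA [cexpt l h * _]mulrC.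
  rewrite (le_trans (ler_rnormD _ _))// -natr1 mulrDl addrC mul1r lerD//.
    rewrite rnormZ (le_trans (ler_piMl _ (cle _ h0))) ?rnorm_ge0//.
    exact: ih.
  exact: hM.
apply/eqP; rewrite -subr_eq0 -rnorm_eq0 eq_le rnorm_ge0 andbT.
have [->|tn0] := eqVneq t 0; first by rewrite T0 cexpt0 scale1r subrr rnorm0.
have tp : 0 < t by rewrite lt_def tn0.
apply/ler_addgt0Pr => eps eps0; rewrite add0r.
(* With this tolerance the k telescoping terms, each at most M (eps / (M t)) (t / k), add up to
   eps. *)
have [|d d0 hd] := step (eps / (M * t)); first by rewrite divr_gt0// mulr_gt0.
pose k := (Num.truncn (t / d)).+1.
have k0 : 0 < k%:R :> R by rewrite ltr0n.
have td : t / k%:R < d by rewrite ltr_pdivrMr// mulrC -ltr_pdivrMr// truncnS_gt.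
have tk : k%:R * (t / k%:R) = t by rewrite mulrC divfK ?gt_eqF.
have h0 : 0 < t / k%:R by rewrite divr_gt0.
have := tel k _ (ltW h0); rewrite tk => /(_ (lexx _)) /le_trans; apply.
rewrite (@le_trans _ _ (k%:R * (M * (eps / (M * t) * (t / k%:R)))))//.
  by rewrite ler_wpM2l ?(ltW k0)// ler_wpM2l ?(ltW M0)// hd.
rewrite le_eqVlt; apply/orP; left; apply/eqP; field.
by rewrite !gt_eqF.
Qed.

End Exponential.

(** * Bochner integrals *)

Section LowerIntegral.
Context d (T : measurableType d) (R : realType) (mu : {measure set T -> \bar R}).
Local Open Scope ereal_scope.

Import HBNNSimple.

(* [f] need not be measurable: the integral is then the supremum of the
   integrals of the nonnegative simple functions below [f]. *)
Lemma ge0_integral_setD_null (D N : set T) (f : T -> \bar R) :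
  (forall x, D x -> 0 <= f x) -> measurable N -> mu N = 0 ->
  \int[mu]_(x in D) f x = \int[mu]_(x in D `\` N) f x.
Proof.
move=> f0 mN N0; apply/eqP; rewrite eq_le; apply/andP; split.
  rewrite !ge0_integralE//; last by move=> x [/f0].
  apply: ge_ereal_sup => _ [h /= hf <-]; apply: ereal_sup_ubound.
  have mNC : measurable (~` N) by exact: measurableC.
  (* Setting [h] to 0 on [N] keeps it simple, puts it below [f] on the smaller set and leaves its
     integral unchanged. *)
  exists (mul_nnsfun h (indic_nnsfun R mNC)) => /=.
    move=> x; rewrite -[X in X%:E]/(h x * \1_(~` N) x)%R indicE in_setC.
    have := hf x; rewrite /patch in_setD.
    case: ifPn => xD; last first.
      by case: (x \notin N) => /=; rewrite ?mulr1 ?mulr0.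
    by case: (x \in N) => /=; rewrite ?mulr1 ?mulr0.
  rewrite -!integralT_nnsfun; apply: ge0_ae_eq_integral => //.
  - by apply/measurable_EFinP; exact: measurable_funP.
  - by apply/measurable_EFinP; exact: measurable_funP.
  - by move=> x _; rewrite lee_fin; exact: fun_ge0.
  - by move=> x _; rewrite lee_fin; exact: fun_ge0.
  exists N; split => // x /= /not_implyP[_]; apply: contra_notP => Nx.
  by rewrite -[X in X%:E = _]/(h x * \1_(~` N) x)%R indicE mem_set// mulr1.
rewrite !ge0_integralE//; last by move=> x [/f0].
apply: le_ereal_sup => _ [h /= hf <-]; exists h => // x.
apply: (le_trans (hf x)); rewrite /patch in_setD.
case: (boolP (x \in D)) => //= xD; case: ifP => // _.
by apply: f0; rewrite inE in xD.
Qed.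

End LowerIntegral.

Section FiniteRange.
Context {d} {T : measurableType d}.

(** The values may lie in any type, so that pairs such as an input value and a grid index are
    covered. Any function whatsoever of such a map is again of this kind, which spares all
    measurability of kernels and norms. *)
Definition finite_measurable_map (I : Type) (p : T -> I) : Prop :=
  finite_set (range p) /\ forall i, measurable (p @^-1` [set i]).

Lemma preimage_comp_bigcup (I J : Type) (p : T -> I) (phi : I -> J) (Y : set J) :
  (phi \o p) @^-1` Y = \bigcup_(i in range p `&` phi @^-1` Y) (p @^-1` [set i]).
Proof.
apply/seteqP; split => [x /= Yx|x [i [_ /= Yi] /= pxi]]; last by rewrite /= pxi.
by exists (p x) => //; split => //; exists x.
Qed.

Lemma finite_map_measurable d' (T' : sigmaRingType d') (I : Type) (p : T -> I)
  (phi : I -> T') : finite_measurable_map p -> measurable_fun setT (phi \o p).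
Proof.
move=> [fp mp] _ Y _; rewrite setTI preimage_comp_bigcup.
by apply: fin_bigcup_measurable => //; exact: finite_setIl.
Qed.

Lemma finite_measurable_comp (I J : Type) (p : T -> I) (phi : I -> J) :
  finite_measurable_map p -> finite_measurable_map (phi \o p).
Proof.
move=> [fp mp]; split.
  by rewrite -(image_comp p phi); exact: finite_image.
move=> j; rewrite preimage_comp_bigcup.
by apply: fin_bigcup_measurable => //; exact: finite_setIl.
Qed.

Lemma finite_measurable_pair (I J : Type) (p : T -> I) (q : T -> J) :
  finite_measurable_map p -> finite_measurable_map q ->
  finite_measurable_map (fun x => (p x, q x)).
Proof.
move=> [fp mp] [fq mq]; split.
  apply: (sub_finite_set _ (finite_setX fp fq)) => _ [x _ <-].
  by split; exists x.
move=> [i j]; rewrite (_ : _ @^-1` _ = p @^-1` [set i] `&` q @^-1` [set j]).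
  exact: measurableI.
by apply/seteqP; split => [x /= [-> ->]|x /= [-> ->]].
Qed.

Variables (R : realType) (mu : {measure set T -> \bar R}) (D : set T).
Hypothesis (mD : measurable D).
Hypothesis (fD : (mu D < +oo)%E).

Definition fibre_weight (I : Type) (p : T -> I) (i : I) : R :=
  fine (mu (D `&` p @^-1` [set i])).

Lemma fibre_weight_ge0 (I : Type) (p : T -> I) (i : I) : 0 <= fibre_weight p i.
Proof. by rewrite /fibre_weight fine_ge0. Qed.

Lemma fibre_weightE (I : Type) (p : T -> I) (i : I) : measurable (p @^-1` [set i]) ->
  (fibre_weight p i)%:E = mu (D `&` p @^-1` [set i]).
Proof.
move=> mp; rewrite fineK// ge0_fin_numE// (le_lt_trans _ fD)//.
by apply: le_measure; rewrite ?inE//; exact: measurableI.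
Qed.

Lemma integral_finite_map (I : choiceType) (p : T -> I) (g : I -> R) :
  finite_measurable_map p -> (forall i, 0 <= g i) ->
  (\int[mu]_(x in D) (g (p x))%:E =
   (\sum_(i <- fset_set (range p)) fibre_weight p i * g i)%:E)%E.
Proof.
move=> [fp mp] g0.
have -> : (\int[mu]_(x in D) (g (p x))%:E =
   \int[mu]_(x in D) \sum_(i <- fset_set (range p)) (g i)%:E * (\1_(p @^-1` [set i]) x)%:E)%E.
  apply: eq_integral => x _.
  rewrite (bigD1_seq (p x))//=; last by rewrite in_fset_set// inE; exists x.
  rewrite indicE mem_set// mule1 big1 ?adde0// => i ip.
  by rewrite indicE memNset ?mule0//=; apply/eqP; rewrite eq_sym.
rewrite ge0_integral_sum//; last 2 first.
- by move=> i; apply/measurable_EFinP; apply: measurable_funM.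
- by move=> i x _; rewrite mule_ge0 ?lee_fin.
rewrite -sumEFin; apply: eq_bigr => i _.
rewrite ge0_integralZl_EFin//; last first.
  by apply/measurable_EFinP; exact: measurable_indic.
by rewrite integral_indic// EFinM fibre_weightE// setIC muleC.
Qed.

Variable (V : normedModType R[i]).

(** Summing over the fibres of [p] instead of those of the composite lets several simple functions
    be expanded over one common partition. *)
Lemma simple_integral_comp (I : choiceType) (p : T -> I) (phi : I -> V) :
  finite_measurable_map p ->
  simple_integral mu D (phi \o p) =
  \sum_(i <- fset_set (range p)) (fibre_weight p i)%:C *: phi i.
Proof.
move=> hp; have [fp mp] := hp; have [fphi mphi] := finite_measurable_comp phi hp.
rewrite /simple_integral fsbig_finite//=.
have w v : fine (mu (D `&` (phi \o p) @^-1` [set v])) =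
    \sum_(i <- fset_set (range p)) fibre_weight p i * (phi i == v)%:R.
  rewrite -[LHS]/(fibre_weight (phi \o p) v); apply: EFin_inj.
  rewrite -(@integral_finite_map _ p (fun i => (phi i == v)%:R))//.
  rewrite fibre_weightE// setIC -integral_indic//.
  apply: eq_integral => x _; rewrite indicE; rewrite (_ : (_ \in _) = (phi (p x) == v))//.
  by apply/idP/eqP => [|pv]; rewrite inE.
under eq_bigr do rewrite w rmorph_sum scaler_suml.
rewrite exchange_big/=; apply: eq_big_seq => i.
rewrite in_fset_set// inE => -[x _ pxi].
rewrite (bigD1_seq (phi i))/=; first last.
- exact: fset_uniq.
- by rewrite in_fset_set// inE; exists x => //=; rewrite pxi.
rewrite eqxx mulr1 big1 ?addr0// => v iv.
by rewrite eq_sym (negbTE iv) mulr0 scale0r.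
Qed.

Lemma simple_on_finite (f : T -> V) : finite_measurable_map f -> simple_on mu D f.
Proof.
move=> [ff mf]; split => // v _; rewrite (le_lt_trans _ fD)//.
by apply: le_measure; rewrite ?inE//; exact: measurableI.
Qed.

Lemma simple_on_finite_map (f : T -> V) : simple_on mu D f -> finite_measurable_map f.
Proof. by case. Qed.

Lemma simple_integral_dist (f g : T -> V) :
  finite_measurable_map f -> finite_measurable_map g ->
  ((rnorm (simple_integral mu D f - simple_integral mu D g))%:E <=
    \int[mu]_(x in D) (rnorm (f x - g x))%:E)%E.
Proof.
move=> hf hg; pose p x := (f x, g x).
have hp : finite_measurable_map p by exact: finite_measurable_pair.
rewrite (_ : f = fst \o p)// (_ : g = snd \o p)//.
rewrite !simple_integral_comp// -sumrB.
rewrite (@integral_finite_map _ p (fun i => rnorm (i.1 - i.2)))//; last first.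
  by move=> i; exact: rnorm_ge0.
rewrite lee_fin (le_trans (ler_rnorm_sum _ _ _))//; apply: ler_sum => i _.
by rewrite -scalerBr rnormZr ger0_norm// fibre_weight_ge0.
Qed.

End FiniteRange.

Section BochnerFacts.
Context {d} {T : measurableType d} {R : realType}.
Variables (mu : {measure set T -> \bar R}) (D : set T).
Hypothesis (mD : measurable D).
Hypothesis (fD : (mu D < +oo)%E).

Lemma measurable_rnorm_dist_lim (V : normedModType R[i]) (E : set T) (s : nat -> T -> V)
    (f g : T -> V) :
  measurable E -> (forall n, finite_measurable_map (s n)) -> finite_measurable_map g ->
  (forall x, E x -> s n x @[n --> \oo] --> f x) ->
  measurable_fun E (fun x => (rnorm (f x - g x))%:E).
Proof.
move=> mE hs hg sf.
apply: (@emeasurable_fun_cvg _ _ _ E (fun n x => (rnorm (s n x - g x))%:E)).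
  move=> n; apply: measurable_funTS.
  exact: (finite_map_measurable (fun q : V * V => (rnorm (q.1 - q.2))%:E)
    (finite_measurable_pair (hs n) hg)).
move=> x Ex; apply: cvg_EFin; first exact: nearW.
apply: cvg_rnorm; apply: cvgB; last exact: cvg_cst.
exact: sf.
Qed.

(* The lower integral of a non-measurable function is not subadditive, whence
   the null set [N] off which [f] is a limit of simple functions. *)
Lemma integral_rnorm_triangle (V : normedModType R[i]) (N : set T)
    (s : nat -> T -> V) (f g h : T -> V) :
  measurable N -> mu N = 0%E -> (forall n, finite_measurable_map (s n)) ->
  (forall x, D x -> ~ N x -> s n x @[n --> \oo] --> f x) ->
  finite_measurable_map g -> finite_measurable_map h ->
  (\int[mu]_(x in D) (rnorm (g x - h x))%:E <=
   \int[mu]_(x in D) (rnorm (f x - g x))%:E +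
   \int[mu]_(x in D) (rnorm (f x - h x))%:E)%E.
Proof.
move=> mN N0 hs sf hg hh.
have mDN : measurable (D `\` N) by exact: measurableD.
rewrite !(@ge0_integral_setD_null _ _ _ mu D N)//; try by move=> x _; rewrite lee_fin rnorm_ge0.
have sf' : forall x, (D `\` N) x -> s n x @[n --> \oo] --> f x.
  by move=> x [Dx Nx]; exact: sf.
have mg := measurable_rnorm_dist_lim mDN hs hg sf'.
have mh := measurable_rnorm_dist_lim mDN hs hh sf'.
have mgh : measurable_fun (D `\` N) (fun x => (rnorm (g x - h x))%:E).
  apply: measurable_funTS.
  exact: (finite_map_measurable (fun q : V * V => (rnorm (q.1 - q.2))%:E)
    (finite_measurable_pair hg hh)).
rewrite -ge0_integralD//; try by move=> x _; rewrite lee_fin rnorm_ge0.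
apply: ge0_le_integral => //; try by move=> x _; rewrite lee_fin rnorm_ge0.
- exact: emeasurable_funD.
- by move=> x _; rewrite -EFinD lee_fin (le_trans (ler_rdistD (f x) _ _))// (rnormB (g x)).
Qed.

(** On a set of finite measure the constant C + C dominates the errors, so they tend to 0 in mean
    and the simple integrals are Cauchy. The given sequence itself is kept in the conclusion,
    because later estimates are read off its integrals. *)
Lemma bochner_integral_bounded_limit (V : completeNormedModType R[i]) (N : set T)
    (s : nat -> T -> V) (f : T -> V) (C : R) :
  measurable N -> mu N = 0%E -> (forall n, finite_measurable_map (s n)) ->
  (forall n x, rnorm (s n x) <= C) ->
  (forall x, D x -> ~ N x -> s n x @[n --> \oo] --> f x) ->
  exists2 w, simple_integral mu D (s n) @[n --> \oo] --> w
    & is_bochner_integral mu D f w.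
Proof.
move=> mN N0 hs sC sf.
have mDN : measurable (D `\` N) by exact: measurableD.
have fDN : (mu (D `\` N) < +oo)%E.
  by rewrite (le_lt_trans _ fD)//; apply: le_measure; rewrite ?inE.
have fC x : D x -> ~ N x -> rnorm (f x) <= C.
  by move=> Dx Nx; apply: (cvg_le_bound (cvg_rnorm (sf x Dx Nx))); exact: nearW.
have i0 : (\int[mu]_(x in D) (rnorm (f x - s n x))%:E)%E @[n --> \oo] --> 0%E.
  have md n : measurable_fun (D `\` N) (fun x => (rnorm (f x - s n x))%:E).
    by apply: (measurable_rnorm_dist_lim mDN hs (hs n)) => x [Dx Nx]; exact: sf.
  have e n : (\int[mu]_(x in D) (rnorm (f x - s n x))%:E =
     \int[mu]_(x in D `\` N) (rnorm (f x - s n x))%:E)%E.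
    by apply: ge0_integral_setD_null => // x _; rewrite lee_fin rnorm_ge0.
  under eq_fun do rewrite e.
  have := @dominated_convergence _ _ _ mu (D `\` N) mDN
    (fun n x => (rnorm (f x - s n x))%:E) (cst 0%E) (cst (C + C)%:E) md.
  case => //.
  - apply: aeW => x [Dx Nx]; apply: cvg_EFin; first exact: nearW.
    under eq_fun do rewrite rnormB.
    by apply/cvg_rnormP; exact: sf.
  - apply/integrableP; split; first exact: measurable_cst.
    rewrite integral_cst//= lte_mul_pinfty//.
  - apply: aeW => x n [Dx Nx].
    rewrite gee0_abs ?lee_fin ?rnorm_ge0// (le_trans (ler_rnormB _ _))//.
    by rewrite lerD// fC.
  by move=> _ _; rewrite integral0.
have cs : cvgn (fun n => simple_integral mu D (s n)).
  apply: rnorm_cauchy_cvg => e e0.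
  have e20 : (0 < (e / 2)%:E)%E by rewrite lte_fin divr_gt0.
  have [M hM] := cvge_lt_near i0 e20.
  exists M => m n Mm Mn; rewrite -lte_fin.
  apply: (le_lt_trans (simple_integral_dist mD fD (hs m) (hs n))).
  apply: (le_lt_trans (integral_rnorm_triangle mN N0 hs sf (hs m) (hs n))).
  by rewrite (splitr e) EFinD lteD// hM.
exists (limn (fun n => simple_integral mu D (s n))) => //.
exists s; split => //.
- by move=> n; exact: simple_on_finite.
- exists N; split => // x /= /not_implyP[Dx]; apply: contra_notP => Nx; exact: sf.
Qed.

Lemma bochner_integral_unique (V : normedModType R[i]) (f : T -> V) (y z : V) :
  is_bochner_integral mu D f y -> is_bochner_integral mu D f z -> y = z.
Proof.
move=> [s [hs [N [mN N0 sN]] si sy]] [s' [hs' _ si' sz]].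
have fs n := simple_on_finite_map (hs n); have fs' n := simple_on_finite_map (hs' n).
have sf x : D x -> ~ N x -> s n x @[n --> \oo] --> f x.
  by move=> Dx; apply: contra_notP => nc; apply: sN => /= /(_ Dx).
apply/eqP; rewrite -subr_eq0 -rnorm_eq0 eq_le rnorm_ge0 andbT.
have h : rnorm (simple_integral mu D (s n) - simple_integral mu D (s' n))
    @[n --> \oo] --> rnorm (y - z).
  by apply: cvg_rnorm; exact: cvgB.
apply/ler_addgt0Pr => e e0; rewrite add0r.
have e20 : (0 < (e / 2)%:E)%E by rewrite lte_fin divr_gt0.
have [M hM] := cvge_lt_near si e20; have [M' hM'] := cvge_lt_near si' e20.
apply: (cvg_le_bound h); exists (maxn M M') => // n /=; rewrite geq_max => /andP[Mn M'n].
rewrite -lee_fin; apply: (le_trans (simple_integral_dist mD fD (fs n) (fs' n))).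
apply: (le_trans (integral_rnorm_triangle mN N0 fs sf (fs n) (fs' n))).
by rewrite (splitr e) EFinD leeD// ltW// ?hM// hM'.
Qed.

End BochnerFacts.

(** * Discretization of inputs and kernels *)

Section Discretization.
Variable (R : realType).
Local Notation leb := (@lebesgue_measure R).

Lemma Linf_enorm_ge0 (U : normedModType R[i]) t (u : R -> U) :
  (0 <= Linf_enorm t u)%E.
Proof.
have muT : (0 < leb setT)%E by rewrite -set_itvNyy lebesgue_measure_itv/= lt0y.
apply: ess_sup_gee; first exact: muT.
apply: nearW => s; rewrite /patch; case: ifP => // _.
by rewrite lee_fin rnorm_ge0.
Qed.

(** Approximants of norm above L + 1 are replaced by 0, which makes the sequence uniformly bounded.
    The margin 1 ensures that, where u is bounded by L, the truncation is eventually inactive. *)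
Lemma Linf_approx (U : normedModType R[i]) t (u : R -> U) : Linf t u ->
  exists (N : set R) (v : nat -> R -> U),
  [/\ measurable N, leb N = 0%E, forall m, finite_measurable_map (v m),
      forall m s, rnorm (v m s) <= Linf_norm t u + 1 &
      forall s, `[0, t]%classic s -> ~ N s -> rnorm (u s) <= Linf_norm t u /\
        v m s @[m --> \oo] --> u s].
Proof.
move=> [[v [hv [N1 [mN1 N10 vN]]]] uoo].
have L0 := Linf_enorm_ge0 t u.
have uE : Linf_enorm t u = (Linf_norm t u)%:E.
  by rewrite /Linf_norm fineK// ge0_fin_numE.
have := @ess_sup_ge _ _ R leb ((fun s => (rnorm (u s))%:E) \_ `[0, t]).
rewrite -/(Linf_enorm t u) uE => -[N2 [mN2 N20 uN]].
set L := Linf_norm t u.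
pose tr (z : U) := if rnorm z <= L + 1 then z else 0.
exists (N1 `|` N2), (fun m s => tr (v m s)).
have L0' : 0 <= L by rewrite -lee_fin /L -uE.
split.
- exact: measurableU.
- by rewrite null_set_setU.
- by move=> m; apply: (finite_measurable_comp tr (simple_on_finite_map (hv m))).
- move=> m s; rewrite /tr; case: ifP => // _.
  by rewrite rnorm0 addr_ge0.
- move=> s st Ns.
  have us : rnorm (u s) <= L.
    have : ~ N2 s by apply: contra_not Ns => ?; right.
    by apply: contra_notP => h; apply: uN => /=; rewrite /patch mem_set//=.
  split => //.
  have vs : v m s @[m --> \oo] --> u s.
    have : ~ N1 s by apply: contra_not Ns => ?; left.
    by apply: contra_notP => h; apply: vN => /= /(_ st).
  have [M hM] := cvg0_nat ((cvg_rnormP _ _).1 vs) ltr01.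
  apply: (cvg_trans _ vs); apply: near_eq_cvg; exists M => // m /= /hM.
  rewrite ger0_norm ?rnorm_ge0// /tr => h; rewrite ifT//.
  have := ler_rnormD (v m s - u s) (u s); rewrite subrK; lra.
Qed.

(** An integer index has finite range on [0, t]; the value 0 elsewhere keeps every grid point inside
    [0, t]. *)
Definition grid_index (t : R) (m : nat) (s : R) : nat :=
  if (0 <= s <= t) then Num.truncn (s * m.+1%:R) else 0%N.

Definition grid_point (t : R) (m : nat) (s : R) : R := (grid_index t m s)%:R / m.+1%:R.

Lemma grid_index_finite t m : 0 <= t -> finite_measurable_map (grid_index t m).
Proof.
move=> t0; split.
  apply: (@sub_finite_set _ _ `I_((Num.truncn (t * m.+1%:R)).+1)); last exact: finite_II.
  move=> _ [s _ <-] /=; rewrite /grid_index; case: ifP => // /andP[s0 st].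
  by rewrite ltnS le_truncn// ler_wpM2r.
move=> i.
have -> : grid_index t m @^-1` [set i] =
    (`[0, t] `&` `[i%:R / m.+1%:R, i.+1%:R / m.+1%:R[) `|`
    (~` `[0, t] `&` [set _ | i = 0%N]).
  have m0 : 0 < m.+1%:R :> R by rewrite ltr0n.
  apply/seteqP; split => s /=; rewrite !in_itv/= /grid_index.
    case: ifPn => [/andP[s0 st]|]; last by move=> /negP ? <-; right.
    move=> /eqP; rewrite truncn_eq ?mulr_ge0// => /andP[h1 h2].
    by left; split => //; rewrite ler_pdivrMr// h1 ltr_pdivlMr.
  move=> [[/andP[s0 st]]|[/negP/negbTE-> ->]//].
  rewrite s0 st/= ler_pdivrMr// ltr_pdivlMr// => h.
  by apply/eqP; rewrite truncn_eq// mulr_ge0.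
apply: measurableU; first exact: measurableI.
apply: measurableI; first exact: measurableC.
have [->|i0] := eqVneq i 0%N.
  by rewrite (_ : [set _ | _] = setT)//; apply/seteqP.
rewrite (_ : [set _ | _] = set0)//; apply/seteqP; split => // s /= /eqP.
by rewrite (negbTE i0).
Qed.

Lemma grid_point_itv t m s : 0 <= t -> 0 <= grid_point t m s <= t.
Proof.
move=> t0; rewrite /grid_point divr_ge0//= ler_pdivrMr// /grid_index.
case: ifP => [/andP[s0 st]|_]; last by rewrite mulr_ge0.
by rewrite (@le_trans _ _ (s * m.+1%:R))// ?ler_wpM2r// truncn_le mulr_ge0.
Qed.

Lemma grid_point_cvg t s : 0 <= s <= t -> grid_point t m s @[m --> \oo] --> s.
Proof.
move=> st; have /andP[s0 _] := st.
have h : s - harmonic m @[m --> \oo] --> s.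
  by rewrite -[s in _ --> s]subr0; apply: cvgB; [exact: cvg_cst|exact: cvg_harmonic].
apply: (squeeze_cvgr _ h (cvg_cst s)); apply: nearW => m.
have m0 : 0 < m.+1%:R :> R by rewrite ltr0n.
rewrite /grid_point /grid_index st /harmonic.
rewrite ler_pdivrMr// truncn_le mulr_ge0// andbT ler_pdivlMr// mulrBl mulVf ?gt_eqF//.
by rewrite lerBlDr natr1 ltW// truncnS_gt.
Qed.

(** Sampling the kernel at the grid point to the left of s makes the integrand a function of an
    input value and a grid index, hence simple. Sequential continuity of [k] within [0, t] gives the
    pointwise limit, and L K is a uniform bound. *)
Lemma kernel_bochner_integral (V : completeNormedModType R[i]) t (u : R -> R[i]^o)
   (k : R -> V) (K L : R) (N : set R) (v : nat -> R -> R[i]^o) :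
  0 <= t -> measurable N -> leb N = 0%E -> (forall m, finite_measurable_map (v m)) ->
  (forall m s, rnorm (v m s) <= L) ->
  (forall s, `[0, t]%classic s -> ~ N s -> v m s @[m --> \oo] --> u s) ->
  (forall s, 0 <= s <= t -> rnorm (k s) <= K) ->
  (forall s (x : nat -> R), 0 <= s <= t -> (forall m, 0 <= x m <= t) ->
     x m @[m --> \oo] --> s -> k (x m) @[m --> \oo] --> k s) ->
  exists2 w, simple_integral leb `[0, t] (fun s => v m s *: k (grid_point t m s))
     @[m --> \oo] --> w
   & is_bochner_integral leb `[0, t] (fun s => u s *: k s) w.
Proof.
move=> t0 mN N0 hv vL vu kK kc.
have mD : measurable (`[0, t]%classic : set R) by exact: measurable_itv.
have fD : (leb `[0%R, t] < +oo)%E.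
  by rewrite /= lebesgue_measure_itv/= lte_fin; case: ifP => // _; rewrite ltry.
apply: (@bochner_integral_bounded_limit _ _ _ leb _ mD fD V N
  (fun m s => v m s *: k (grid_point t m s)) (fun s => u s *: k s) (L * K)) => //.
- move=> m.
  exact: (finite_measurable_comp (fun p : R[i]^o * nat => p.1 *: k (p.2%:R / m.+1%:R))
    (finite_measurable_pair (hv m) (grid_index_finite m t0))).
- move=> m s; rewrite rnormZ ler_pM ?rnorm_ge0//.
  by rewrite kK// grid_point_itv.
- move=> s st Ns; apply: cvgZ; first exact: vu.
  have st' : 0 <= s <= t by move: st; rewrite /= in_itv.
  by apply: kc => // [m|]; [exact: grid_point_itv|exact: grid_point_cvg].
Qed.

End Discretization.

(** * Riesz bases *)

Section Weights.
Variable (R : realType).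

(** A discrete form of the integral of 1 / sqrt: the difference of the two sides, times sqrt t, is
    the square of sqrt t - sqrt s. *)
Lemma sqrt_telescope (s t : R) : 0 < t -> 0 <= s -> s <= t ->
  (t - s) / Num.sqrt t <= 2 * (Num.sqrt t - Num.sqrt s).
Proof.
move=> t0 s0 st; rewrite ler_pdivrMr ?sqrtr_gt0//.
have {1}-> : t = Num.sqrt t ^+ 2 by rewrite sqr_sqrtr// ltW.
have {1}-> : s = Num.sqrt s ^+ 2 by rewrite sqr_sqrtr.
have := sqrtr_ge0 s; have : Num.sqrt s <= Num.sqrt t by exact: ler_wsqrtr.
set x := Num.sqrt s; set y := Num.sqrt t => xy x0.
rewrite -subr_ge0 (_ : _ - _ = (y - x) ^+ 2); last by ring.
exact: sqr_ge0.
Qed.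

(* With [t n] a positive null sequence whose decrements dominate [a], one takes
   [kappa n ^ p = 1 + t n ^ (-1/2)] and sums [(t n - t n.+1) / sqrt (t n)]. *)
Lemma slow_weights (a : nat -> R) (p C : R) : 0 < p -> (forall n, 0 <= a n) ->
  (forall n, \sum_(0 <= i < n) a i <= C) ->
  exists kappa : nat -> R, [/\ forall n, 1 <= kappa n,
    forall M, exists N, forall n, (N <= n)%N -> M < kappa n &
    exists C', forall n, \sum_(0 <= i < n) a i * kappa i `^ p <= C'].
Proof.
move=> p0 a0 aC.
have nda : nondecreasing_seq (series a).
  by apply: nondecreasing_series => n _ _; exact: a0.
have ca : cvgn (series a).
  by apply: nondecreasing_is_cvgn => //; exists C => _ [n _ <-]; exact: aC.
pose S := limn (series a).
have aS n : series a n <= S by exact: nondecreasing_cvgn_le.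
(* The tail of the series may vanish from some index on; the added 2^-n keeps [t n] positive. *)
pose t n := (S - series a n) + (2 ^- n : R).
have p2 n : 0 < (2 ^- n : R) by rewrite invr_gt0 exprn_gt0.
have t0 n : 0 < t n by rewrite ltr_wpDl// subr_ge0.
have at1 n : a n <= t n - t n.+1.
  rewrite /t {2}/series/= big_nat_recr//= -/(series a n).
  have : (2 ^- n.+1 : R) <= 2 ^- n.
    by rewrite lef_pV2 ?posrE ?exprn_gt0// ler_eXn2l// ltr1n.
  rewrite /series /=; lra.
have tcvg : t n @[n --> \oo] --> 0.
  rewrite -[X in _ --> X](addr0 0) -{1}(subrr S); apply: cvgD.
    by apply: cvgB => //; exact: cvg_cst.
  under eq_fun do rewrite -exprVn.
  by apply: cvg_expr; rewrite ger0_norm ?invr_ge0// invf_lt1// ltr1n.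
pose kappa n := (1 + (Num.sqrt (t n))^-1) `^ p^-1.
have kp n : kappa n `^ p = 1 + (Num.sqrt (t n))^-1.
  by rewrite /kappa -powRrM mulVf ?gt_eqF// powRr1// addr_ge0// invr_ge0 sqrtr_ge0.
have k1 n : 1 <= kappa n.
  have h : 1 `^ p^-1 = 1 :> R by rewrite powR1.
  rewrite /kappa -[leLHS]h; apply: ge0_ler_powR.
  - by rewrite invr_ge0 ltW.
  - by rewrite nnegrE.
  - by rewrite nnegrE addr_ge0// invr_ge0 sqrtr_ge0.
  - by rewrite lerDl invr_ge0 sqrtr_ge0.
exists kappa; split => //.
- move=> M; pose M' := Num.max M 1.
  have M0 : 0 < M' `^ p by rewrite powR_gt0// lt_max ltr01 orbT.
  have e0 : 0 < (M' `^ p) ^- 2 by rewrite invr_gt0 exprn_gt0.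
  have [N hN] := cvg0_nat tcvg e0.
  exists N => n /hN; rewrite gtr0_norm// => tn.
  rewrite (@le_lt_trans _ _ M')// ?le_max ?lexx// ltNge; apply/negP => kM.
  have : kappa n `^ p <= M' `^ p.
    apply: ge0_ler_powR => //; first exact: ltW.
    - by rewrite nnegrE (le_trans _ (k1 n)).
    - by rewrite nnegrE (le_trans (le_trans _ (k1 n)) kM).
  apply/negP; rewrite -ltNge kp.
  have : Num.sqrt (t n) < (M' `^ p)^-1.
    rewrite -[ltRHS]ger0_norm ?invr_ge0 ?ltW// -sqrtr_sqr ltr_sqrt ?exprVn//.
  move=> h.
  have : (Num.sqrt (t n)) ^-1 > (M' `^ p)^-1^-1.
    by rewrite ltf_pV2 ?posrE ?invr_gt0 ?sqrtr_gt0.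
  rewrite invrK; lra.
exists (C + 2 * Num.sqrt (t 0%N)) => n.
apply: (@le_trans _ _ (\sum_(0 <= i < n) (a i + 2 * (Num.sqrt (t i) - Num.sqrt (t i.+1))))).
  apply: ler_sum => i _; rewrite kp mulrDr mulr1 lerD2l.
  apply: (le_trans _ (sqrt_telescope (t0 i) (ltW (t0 i.+1)) _)).
    by rewrite ler_wpM2r// invr_ge0 sqrtr_ge0.
  by rewrite -subr_ge0 (le_trans (a0 i)).
rewrite big_split/= lerD// -mulr_sumr ler_wpM2l//.
rewrite (_ : \sum_(0 <= i < n) _ = Num.sqrt (t 0%N) - Num.sqrt (t n)).
  by rewrite gerBl sqrtr_ge0.
rewrite -[RHS]opprB -(telescope_sumr (fun i => Num.sqrt (t i)))// -sumrN.
by apply: eq_bigr => i _; rewrite opprB.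
Qed.

End Weights.

Section RieszBasis.
Variables (R : realType) (X : completeNormedModType R[i]) (q : R) (e : nat -> X).
Hypotheses (hq : 1 <= q) (he : q_riesz_basis q e).

Let q0 : 0 < q. Proof. by rewrite (lt_le_trans ltr01). Qed.

Lemma sum_window (V : nmodType) (F : nat -> V) m n N : (n <= N)%N ->
  \sum_(0 <= i < N) (if (m <= i < n)%N then F i else 0) = \sum_(m <= i < n) F i.
Proof.
move=> nN; rewrite -big_mkcond /= [RHS](big_nat_widen _ _ N)//.
rewrite [RHS](big_nat_widenl _ 0%N)//=.
by apply: eq_bigl => i; rewrite andbC.
Qed.

(** Extending a window of coefficients by 0 makes both series eventually constant, so their limits
    are the finite sums. *)
Lemma riesz_finite : exists c1 c2 : R, [/\ 0 < c1, 0 < c2 &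
  forall (a : nat -> R[i]) m n,
    c1 * \sum_(m <= i < n) rnorm (a i) `^ q <=
      rnorm (\sum_(m <= i < n) a i *: e i) `^ q <=
    c2 * \sum_(m <= i < n) rnorm (a i) `^ q].
Proof.
have [_ [c1 [c2 [c10 c20 h]]]] := he.
exists c1, c2; split => // a m n.
pose a' i := if (m <= i < n)%N then a i else 0.
have s1 N : (n <= N)%N -> series (fun k => rnorm (a' k) `^ q) N =
    \sum_(m <= i < n) rnorm (a i) `^ q.
  move=> nN; rewrite -(sum_window (fun i => rnorm (a i) `^ q) m nN) /series /=.
  apply: eq_bigr => i _; rewrite /a'; case: ifP => // _.
  by rewrite rnorm0 powR0// gt_eqF.
have s2 N : (n <= N)%N -> series (fun k => a' k *: e k) N = \sum_(m <= i < n) a i *: e i.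
  move=> nN; rewrite -(sum_window (fun i => a i *: e i) m nN) /series /=.
  by apply: eq_bigr => i _; rewrite /a'; case: ifP => // _; rewrite scale0r.
have l1 : series (fun k => rnorm (a' k) `^ q) @ \oo --> \sum_(m <= i < n) rnorm (a i) `^ q.
  by apply: cvg_near_cst; exists n => // N; exact: s1.
have l2 : series (fun k => a' k *: e k) @ \oo --> \sum_(m <= i < n) a i *: e i.
  by apply: cvg_near_cst; exists n => // N; exact: s2.
have ela : ell q a' by apply/cvg_ex; eexists; exact: l1.
have [_] := h a' ela.
by rewrite (cvg_lim _ l1)// (cvg_lim _ l2)// => -> ->.
Qed.

(** The constant is (c2 / c1)^(1/q): one passes from [b] to its coefficients by the upper inequality
    and back to [a] by the lower one. Arbitrary windows are allowed so that the same bound yields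
    Cauchy estimates. *)
Lemma riesz_multiplier : exists2 K : R, 0 < K &
  forall (a b : nat -> R[i]) B m n, 0 <= B ->
    (forall i, (m <= i < n)%N -> rnorm (b i) <= B * rnorm (a i)) ->
    rnorm (\sum_(m <= i < n) b i *: e i) <= K * B * rnorm (\sum_(m <= i < n) a i *: e i).
Proof.
have [c1 [c2 [c10 c20 h]]] := riesz_finite.
have K0 : 0 < (c2 / c1) `^ q^-1 by rewrite powR_gt0// divr_gt0.
have Kq : ((c2 / c1) `^ q^-1) `^ q = c2 / c1.
  by rewrite -powRrM mulVf ?gt_eqF// powRr1 ?divr_ge0 ?(ltW c20) ?(ltW c10)//.
move: (_ `^ q^-1) K0 Kq => K K0 Kq; exists K => // a b B m n B0 ba.
have /andP[_ h1] := h b m n; have /andP[h2 _] := h a m n.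
rewrite leNgt; apply/negP => /(gt0_ltr_powR q0).
rewrite !nnegrE !mulr_ge0 ?rnorm_ge0 ?(ltW K0)// => /(_ isT isT).
apply/negP; rewrite -leNgt (le_trans h1)//.
rewrite !powRM ?rnorm_ge0 ?mulr_ge0 ?(ltW K0)//.
rewrite Kq (@le_trans _ _ (c2 * (B `^ q * \sum_(m <= i < n) rnorm (a i) `^ q)))//.
  rewrite ler_wpM2l ?(ltW c20)// mulr_sumr; apply: ler_sum_nat => i mi.
  rewrite -powRM ?rnorm_ge0//; apply: ge0_ler_powR;
    rewrite ?nnegrE ?rnorm_ge0 ?mulr_ge0 ?rnorm_ge0//.
  - exact: ltW.
  - exact: ba.
rewrite -!mulrA ler_wpM2l ?(ltW c20)// mulrCA ler_wpM2l ?powR_ge0//.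
by rewrite ler_pdivlMl.
Qed.

(** Bounded partial sums make |zeta_k|^q summable by the lower Riesz inequality. The slow weights
    are taken with exponent 2 q, since kappa_k^2 enters the q-th power of the coefficient. *)
Lemma riesz_weights (zeta : nat -> R[i]) : cvgn (series (fun k => zeta k *: e k)) ->
  exists kappa : nat -> R, [/\ forall n, 1 <= kappa n,
    forall M, exists N, forall n, (N <= n)%N -> M < kappa n &
    cvgn (series (fun k => ((kappa k ^+ 2)%:C * zeta k) *: e k))].
Proof.
move=> cz; have [c1 [c2 [c10 c20 h]]] := riesz_finite.
have [C hC] : exists C, forall n, \sum_(0 <= i < n) rnorm (zeta i) `^ q <= C.
  have [M M0 hM] : exists2 M : R, 0 < M &
     forall n, rnorm (series (fun k => zeta k *: e k) n) <= M.
    exact: cvg_rnorm_bounded.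
  exists (M `^ q / c1) => n; have /andP[h1 _] := h zeta 0%N n.
  rewrite ler_pdivlMr// mulrC (le_trans h1)//; apply: ge0_ler_powR;
    rewrite ?nnegrE ?rnorm_ge0 ?(ltW q0) ?(ltW M0)//; exact: hM.
have p0 : 0 < 2 * q by rewrite mulr_gt0.
have [kappa [k1 koo [C' hC']]] := slow_weights p0 (fun n => powR_ge0 (rnorm (zeta n)) q) hC.
exists kappa; split => //.
have [_ [d1 [d2 [_ _ hd]]]] := he.
have [] // := hd (fun k => (kappa k ^+ 2)%:C * zeta k); rewrite /ell; apply: nondecreasing_is_cvgn.
  by apply: nondecreasing_series => n _ _; exact: powR_ge0.
exists C' => _ [n _ <-]; apply: le_trans (hC' n).
rewrite /series /=; apply: ler_sum => i _.
have k0 : 0 <= kappa i by rewrite (le_trans _ (k1 i)).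
rewrite rnormM rnormc_real ger0_norm ?exprn_ge0// powRM ?exprn_ge0 ?rnorm_ge0//.
by rewrite mulrC -powR_mulrn// -powRrM.
Qed.

End RieszBasis.

(** * Comparison functions *)

Section ComparisonFunctions.
Variable (R : realType).

Lemma locally_lipschitz_cvg (f : R -> R) (x d L : R) : 0 < d -> 0 <= L ->
  (forall v, `|v - x| < d -> `|f v - f x| <= L * `|v - x|) -> f v @[v --> x] --> f x.
Proof.
move=> d0 L0 lip; apply/cvgrPdist_lt => eps eps0.
have L1 : 0 < L + 1 by lra.
have m0 : 0 < Num.min d (eps / (L + 1)) by rewrite lt_min d0 divr_gt0.
have : nbhs x (ball x (Num.min d (eps / (L + 1)))) by exact: nbhsx_ballx.
apply: filterS => v; rewrite /ball/= lt_min distrC => /andP[vd ve].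
rewrite distrC (le_lt_trans (lip v vd))//.
rewrite (@le_lt_trans _ _ ((L + 1) * `|v - x|))//; first by rewrite ler_wpM2r// lerDl.
by rewrite mulrC -ltr_pdivlMr.
Qed.

Section Gain.
Variables (r kappa : nat -> R).
Hypotheses (r0 : forall n, 0 <= r n) (k0 : forall n, 0 <= kappa n).
Hypothesis koo : forall M, exists N, forall n, (N <= n)%N -> M < kappa n.

(** The leading [v] makes the function strictly increasing also where no term of the sum is
    active. *)
Definition gain (v : R) : R :=
  v + limn (series (fun n => r n * Num.max 0 (v - kappa n))).

(** One cutoff [N] serves all arguments up to [V], so two values of the gain are compared inside one
    finite sum. *)
Lemma gainE V : exists2 N, forall n, (N <= n)%N -> V < kappa n &
  forall v, v <= V -> gain v = v + \sum_(0 <= n < N) r n * Num.max 0 (v - kappa n).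
Proof.
have [N hN] := koo V; exists N => // v vV; congr (_ + _).
apply: cvg_lim => //; apply: cvg_near_cst; exists N => // m /= Nm.
rewrite /series /= (big_cat_nat (n := N))//= [X in _ + X]big_nat.
rewrite [X in _ + X]big1 ?addr0// => i /andP[Ni _].
by rewrite max_l ?mulr0// subr_le0 ltW// (le_lt_trans vV)// hN.
Qed.

Lemma ler_dist_max0 (a b : R) : `|Num.max 0 a - Num.max 0 b| <= `|a - b|.
Proof.
have h (x y : R) : Num.max 0 x - Num.max 0 y <= `|x - y|.
  have : x - y <= `|x - y| by exact: ler_norm.
  have := normr_ge0 (x - y).
  case: (leP 0 x) => x0; case: (leP 0 y) => y0; lra.
rewrite ler_norml h andbT; have := h b a; rewrite distrC; lra.
Qed.

Lemma gain_continuous : continuous gain.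
Proof.
move=> x; have [N _ hN] := gainE (x + 1).
pose L := 1 + \sum_(0 <= n < N) r n.
have lip v : v <= x + 1 -> `|gain v - gain x| <= L * `|v - x|.
  move=> vx; rewrite !hN ?lerDl// opprD addrACA -sumrB mulrDl mul1r.
  rewrite (le_trans (ler_normD _ _))// lerD2l (le_trans (ler_norm_sum _ _ _))//.
  rewrite mulr_suml; apply: ler_sum => i _.
  rewrite -mulrBr normrM ger0_norm// ler_wpM2l// (le_trans (ler_dist_max0 _ _))//.
  by rewrite (_ : v - _ - _ = v - x)//; ring.
apply: (@locally_lipschitz_cvg _ _ 1 L) => //; first by rewrite addr_ge0// sumr_ge0.
by move=> v; rewrite ltr_norml => /andP[_ vx]; apply: lip; lra.
Qed.

Lemma le_gain v : 0 <= v -> v <= gain v.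
Proof.
move=> v0; have [N _ ->//] := gainE v; rewrite lerDl sumr_ge0// => i _.
by rewrite mulr_ge0// le_max lexx.
Qed.

Lemma gain_classK : classK gain.
Proof.
split.
- exact/continuous_subspaceT/gain_continuous.
- by move=> x x0; rewrite (le_trans x0)// le_gain.
- move=> x y x0 xy; have [N _ hN] := gainE y.
  rewrite (hN x (ltW xy)) (hN y (lexx y)) ltr_leD//; apply: ler_sum => i _.
  by rewrite ler_wpM2l// ge_max le_max lexx/= le_max lerD2r (ltW xy) orbT.
- have [N _ ->//] := gainE 0; rewrite add0r big1// => i _.
  by rewrite sub0r max_l ?mulr0// oppr_le0.
Qed.

(* If [4 / delta <= v] and [delta * kappa n ^ 2 < v], then [kappa n < v / 2] and
   the [n]-th term of [gain v] is at least [r n * v / 2]; below [4 / delta] only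
   finitely many [n] occur. *)
Lemma gain_superlinear delta : 0 < delta -> exists2 C, 0 <= C &
  forall n v, 0 <= v -> delta * kappa n ^+ 2 < v -> r n * v <= C * gain v.
Proof.
move=> d0; have [N hN] := koo (2 / delta).
pose B := \sum_(0 <= i < N) r i.
have B0 : 0 <= B by exact: sumr_ge0.
(* The 2 serves large [v], where half of r_n v is recovered; [B] bounds r_n for the finitely many
   modes that matter for small [v]. *)
exists (2 + B); first by rewrite addr_ge0.
move=> n v v0 kv.
have gv := le_gain v0.
have g0 : 0 <= gain v by rewrite (le_trans v0).
have [v4|v4] := leP (4 / delta) v.
  have kn : kappa n < v / 2.
    rewrite -(@ltr_pXn2r _ 2)// ?nnegrE//; last by rewrite divr_ge0.
    rewrite -(ltr_pM2l d0) (lt_le_trans kv)//.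
    rewrite ler_pdivrMr// in v4.
    have -> : delta * (v / 2) ^+ 2 = (v * delta) / 4 * v by field.
    by rewrite ler_peMl// ler_pdivlMr// mul1r.
  have h : r n * (v - kappa n) <= gain v.
    have [M kM ->//] := gainE v.
    have nM : (n < M)%N.
      by rewrite ltnNge; apply/negP => /kM;
        rewrite ltNge (le_trans (ltW kn))// ler_pdivrMr// ler_peMr// ler1n.
    rewrite (bigD1_seq n)/= ?iota_uniq ?mem_index_iota//.
    have : r n * (v - kappa n) <= r n * Num.max 0 (v - kappa n).
      by rewrite ler_wpM2l// le_max lexx orbT.
    have : 0 <= \sum_(0 <= i < M | i != n) r i * Num.max 0 (v - kappa i).
      by apply: sumr_ge0 => i _; rewrite mulr_ge0// le_max lexx.
    lra.
  have := r0 n; nra.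
have kn : kappa n < 2 / delta.
  rewrite -(@ltr_pXn2r _ 2)// ?nnegrE//; last by rewrite divr_ge0// ltW.
  rewrite -(ltr_pM2l d0) (lt_trans kv)// (lt_le_trans v4)//.
  by rewrite le_eqVlt; apply/orP; left; apply/eqP; field; rewrite gt_eqF.
have nN : (n < N)%N.
  by rewrite ltnNge; apply/negP => /hN; rewrite ltNge ltW.
have rB : r n <= B.
  by rewrite /B (bigD1_seq n)/= ?iota_uniq ?mem_index_iota// lerDl sumr_ge0.
rewrite (@le_trans _ _ (B * v))//; first by rewrite ler_wpM2r.
by rewrite ler_pM// lerDr.
Qed.

End Gain.

(* An infimum of nonnegative increasing affine functions [h] is nondecreasing
   and [h x / x] is nonincreasing, which makes it continuous. *)
Lemma affine_envelope (C : R -> R) (K : R) : 0 <= K -> (forall d, 0 < d -> 0 <= C d) ->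
  exists theta : R -> R, classKoo theta /\
    forall E I, 0 <= I -> (forall d, 0 < d -> E <= K * (d + C d * I)) -> E <= theta I.
Proof.
move=> K0 C0.
pose S I := [set d + C d * I | d in [set d : R | 0 < d]].
have S0 I : 0 <= I -> has_inf (S I).
  move=> I0; split; first by exists (1 + C 1 * I), 1 => //=.
  by exists 0 => _ [d /= d0 <-]; rewrite addr_ge0 ?mulr_ge0 ?(ltW d0) ?C0.
pose h I := inf (S I).
have hle I d : 0 <= I -> 0 < d -> h I <= d + C d * I.
  by move=> I0 d0; apply: ge_inf; [exact: (S0 I I0).2 | exists d].
have hge I b : 0 <= I -> (forall d, 0 < d -> b <= d + C d * I) -> b <= h I.
  move=> I0 hb; apply: lb_le_inf; first exact: (S0 I I0).1.
  by move=> _ [d /= d0 <-]; exact: hb.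
have h0 I : 0 <= I -> 0 <= h I.
  by move=> I0; apply: hge => // d d0; rewrite addr_ge0 ?mulr_ge0 ?(ltW d0) ?C0.
have h00 : h 0 = 0.
  apply/eqP; rewrite eq_le h0// andbT; apply/ler_addgt0Pr => d d0; rewrite add0r.
  by rewrite (le_trans (hle 0 d _ d0))// mulr0 addr0.
have hmono x y : 0 <= x -> x <= y -> h x <= h y.
  move=> x0 xy; apply: hge; first exact: le_trans xy.
  move=> d d0; rewrite (le_trans (hle x d x0 d0))// lerD2l ler_wpM2l// C0//.
have hscale x l : 0 <= x -> 0 <= l -> l <= 1 -> l * h x <= h (l * x).
  move=> x0 l0 l1; apply: hge; first exact: mulr_ge0.
  move=> d d0; rewrite (@le_trans _ _ (l * (d + C d * x)))//.
    by rewrite ler_wpM2l// hle.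
  by rewrite mulrDr mulrCA lerD2r ler_piMl// ltW.
(* Monotonicity of h and of h x / x together bound the increments on both sides of x by the slope h
   x / x. *)
have hlip x y : 0 < x -> 0 <= y -> `|h y - h x| <= h x / x * `|y - x|.
  move=> x0 y0; have [yx|xy] := leP y x.
    have := hscale x (y / x) (ltW x0); rewrite divr_ge0 ?(ltW x0)// ler_pdivrMr// mul1r.
    move=> /(_ isT yx); rewrite divfK ?gt_eqF// => h1.
    rewrite ler0_norm ?subr_le0 ?hmono// ler0_norm ?subr_le0// !opprB.
    rewrite mulrBr divfK ?gt_eqF//; lra.
  have y0' : 0 < y by exact: lt_trans xy.
  have := hscale y (x / y) (ltW y0'); rewrite divr_ge0 ?(ltW x0)// ler_pdivrMr// mul1r.
  move=> /(_ isT (ltW xy)); rewrite divfK ?gt_eqF// => h1.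
  have h2 : h y <= h x / x * y.
    by rewrite mulrAC ler_pdivlMr//; move: h1; rewrite mulrC mulrA ler_pdivrMr// mulrC.
  rewrite ger0_norm ?subr_ge0 ?hmono ?(ltW x0) ?(ltW xy)// ger0_norm ?subr_ge0 ?(ltW xy)//.
  rewrite mulrBr divfK ?gt_eqF//; lra.
(* The added [I] gives strict growth and divergence at infinity, neither of which the envelope has
   in general. *)
exists (fun I => K * h I + I); split; last first.
  move=> E I I0 hE; rewrite (@le_trans _ _ (K * h I))//; last by rewrite lerDl.
  have [K00|Kn0] := eqVneq K 0.
    by have := hE 1 ltr01; rewrite K00 !mul0r.
  have Kp : 0 < K by rewrite lt_def Kn0.
  rewrite -ler_pdivrMl//; apply: hge => // d d0; rewrite ler_pdivrMl//.
  exact: hE.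
split; first split.
- apply/continuous_within_itvcyP; split.
    move=> x; rewrite in_itv/= andbT => x0; apply: cvgD; last exact: cvg_id.
    apply: cvgMl_tmp; apply: (@locally_lipschitz_cvg _ _ x (h x / x)) => //.
      by rewrite divr_ge0 ?h0// ltW.
    move=> v; rewrite ltr_norml => /andP[vx _]; apply: hlip => //; lra.
  apply: cvgD; last by apply: cvg_at_right_filter; exact: cvg_id.
  apply: cvgMl_tmp; rewrite h00; apply/cvgrPdist_le => eps eps0.
  have e20 : 0 < eps / 2 by lra.
  have C1 : 0 < C (eps / 2) + 1 by rewrite ltr_wpDl ?C0.
  near=> y.
  have y0 : 0 < y by near: y; exact: nbhs_right_gt.
  have ye : y < eps / 2 / (C (eps / 2) + 1) by near: y; apply: nbhs_right_lt; rewrite divr_gt0.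
  rewrite sub0r normrN ger0_norm ?h0 ?(ltW y0)//.
  rewrite (le_trans (hle y (eps / 2) (ltW y0) e20))//.
  have : C (eps / 2) * y <= (C (eps / 2) + 1) * y by rewrite ler_wpM2r ?(ltW y0)// lerDl.
  move: ye; rewrite ltr_pdivlMr// mulrC; lra.
- by move=> x x0; rewrite addr_ge0// mulr_ge0// h0.
- by move=> x y x0 xy; apply: ler_ltD => //; rewrite ler_wpM2l// hmono// ltW.
- by rewrite h00 mulr0 addr0.
- apply: (@ger_cvgy _ _ _ _ id); last exact: cvg_id.
  exists 0; split => // x x0.
  by rewrite lerDr mulr_ge0// h0// ltW.
Unshelve. all: by end_near. Qed.

Lemma linear_classKoo (c : R) : 0 < c -> classKoo (fun s => c * s).
Proof.
move=> c0; split; last first.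
  by under eq_fun do rewrite mulrC; apply: gt0_cvgMly; [exact: c0 | exact: cvg_id].
split.
- by apply: continuous_subspaceT => x; apply: cvgMl_tmp; exact: cvg_id.
- by move=> x x0; rewrite mulr_ge0// ltW.
- by move=> x y _ xy; rewrite ltr_pM2l.
- by rewrite mulr0.
Qed.

Lemma exponential_classKL (M w : R) : 0 < M -> 0 < w ->
  classKL (fun s t => M * expR (- w * t) * s).
Proof.
move=> M0 w0; split.
  by move=> t t0; have [] := @linear_classKoo (M * expR (- w * t)) (mulr_gt0 M0 (expR_gt0 _)).
move=> s s0; split.
- apply: continuous_subspaceT => x; apply: cvgMr_tmp; apply: cvgMl_tmp.
  apply: (@continuous_comp _ _ _ ( *%R (- w)) expR); last exact: continuous_expR.
  by apply: cvgMl_tmp; exact: cvg_id.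
- by move=> t t0; rewrite !mulr_ge0 ?expR_ge0 ?ltW.
- by move=> x y x0 xy; rewrite ltr_pM2r// ltr_pM2l// ltr_expR ltr_nM2l// oppr_lt0.
- rewrite -(mul0r s); apply: cvgMr_tmp; rewrite -(mulr0 M); apply: cvgMl_tmp.
  under eq_fun do rewrite mulNr.
  have h : w * t @[t --> +oo] --> +oo.
    by under eq_fun do rewrite mulrC; apply: gt0_cvgMly => //; exact: cvg_id.
  exact: (cvg_comp _ _ h (@cvgr_expR R)).
Qed.

End ComparisonFunctions.

(** * Exponential weights *)

Section ExponentialIntegral.
Variable (R : realType).
Local Notation leb := (@lebesgue_measure R).

(** The sign c = 1 or -1 treats the weights exp(- r (t - s)) and exp(- r s) together; as c is its
    own inverse, the antiderivative is c times the exponential. *)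
Lemma integral_expR_affine (r c d t : R) : c ^+ 2 = 1 -> 0 < t ->
  (\int[leb]_(s in `[0%R, t]) (r * expR (r * (c * s + d)))%:E =
   (c * expR (r * (c * t + d)) - c * expR (r * d))%:E)%E.
Proof.
move=> c2 t0.
pose F s := c * expR (r * (c * s + d)).
have dF (x : R) : is_derive x (1 : R) F (r * expR (r * (c * x + d))).
  have d1 : is_derive x (1 : R) (fun s => r * (c * s + d)) (r * c).
    have := is_deriveZ r (is_deriveD (is_deriveZ c (is_derive_id x (1 : R)))
       (is_derive_cst d x 1)).
    by rewrite addr0 [c *: _]mulr1.
  have := is_deriveZ c (@is_derive1_comp R expR _ _ _ _ (is_derive_expR _) d1).
  rewrite (_ : c *: _ = c ^+ 2 * (r * expR (r * (c * x + d)))).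
    by rewrite c2 mul1r.
  by rewrite /GRing.scale/=; ring.
have cF : continuous F.
  by move=> x; apply: differentiable_continuous; apply/derivable1_diffP; have [] := dF x.
have cf : continuous (fun s => r * expR (r * (c * s + d))).
  have -> : (fun s => r * expR (r * (c * s + d))) = (fun s => (r / c) * F s).
    apply/funext => s; rewrite /F mulrA divfK//.
    by apply: contra_eqN c2 => /eqP ->; rewrite expr0n/= eq_sym oner_eq0.
  by move=> x; apply: cvgMl_tmp; exact: cF.
rewrite (@continuous_FTC2 _ _ F)//.
- by rewrite /F mulr0 add0r EFinB.
- exact: continuous_subspaceT.
- split.
  + by move=> x _; have [] := dF x.
  + by apply: cvg_at_right_filter; exact: cF.
  + by apply: cvg_at_left_filter; exact: cF.
- by move=> x _; rewrite derive1E; have [_ ->] := dF x.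
Qed.

Lemma integral_expR_le1 (r c d t : R) : c ^+ 2 = 1 -> 0 <= t ->
  c * expR (r * (c * t + d)) - c * expR (r * d) <= 1 ->
  (\int[leb]_(s in `[0%R, t]) (r * expR (r * (c * s + d)))%:E <= 1)%E.
Proof.
move=> c2; rewrite le_eqVlt => /predU1P[<- _|t0 h].
  by rewrite set_itv1 integral_set1.
by rewrite integral_expR_affine// lee_fin.
Qed.

Lemma integral_expR_forward (r t : R) : 0 < r -> 0 <= t ->
  (\int[leb]_(s in `[0%R, t]) (r * expR (- r * s))%:E <= 1)%E.
Proof.
move=> r0 t0.
have e s : - r * s = r * (-1 * s + 0) by ring.
under eq_integral do rewrite e.
apply: integral_expR_le1 => //; first by rewrite sqrrN expr1n.
rewrite mulr0 expR0 !mulN1r addr0 opprK -lerBrDr subrr oppr_le0; exact: expR_ge0.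
Qed.

Lemma integral_expR_backward (r t : R) : 0 < r -> 0 <= t ->
  (\int[leb]_(s in `[0%R, t]) (r * expR (- r * (t - s)))%:E <= 1)%E.
Proof.
move=> r0 t0.
have e s : - r * (t - s) = r * (1 * s + - t) by ring.
under eq_integral do rewrite e.
apply: integral_expR_le1 => //; first by rewrite expr1n.
by rewrite !mul1r subrr mulr0 expR0 gerBl expR_ge0.
Qed.

End ExponentialIntegral.

Section SimpleIntegralFacts.
Context {d} {T : measurableType d} {R : realType}.
Variables (mu : {measure set T -> \bar R}) (D : set T).
Hypothesis (mD : measurable D).
Hypothesis (fD : (mu D < +oo)%E).

Lemma simple_integral_linear (V W : normedModType R[i]) (j : V -> W) (f : T -> V) :
  linear j -> finite_measurable_map f ->
  simple_integral mu D (j \o f) = j (simple_integral mu D f).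
Proof.
move=> lj hf.
have -> : simple_integral mu D f = simple_integral mu D (id \o f) by [].
rewrite !(simple_integral_comp mD fD)// (linearf_sum _ _ _ lj).
by apply: eq_bigr => i _; rewrite (linearfZ _ _ lj).
Qed.

(** The coefficients [alpha] do not depend on [M], so one sequence describes all truncations and
    differences of truncations are windows. *)
Lemma simple_integral_combination (V : normedModType R[i]) (I : choiceType) (p : T -> I)
    (phi : nat -> I -> R[i]) (x : nat -> V) : finite_measurable_map p ->
  exists alpha : nat -> R[i],
    (forall M, simple_integral mu D (fun s => \sum_(0 <= k < M) phi k (p s) *: x k) =
       \sum_(0 <= k < M) alpha k *: x k) /\
    (forall k, ((rnorm (alpha k))%:E <= \int[mu]_(s in D) (rnorm (phi k (p s)))%:E)%E).
Proof.
move=> hp.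
exists (fun k => \sum_(i <- fset_set (range p)) (fibre_weight mu D p i)%:C * phi k i).
split=> [M|k].
  rewrite (simple_integral_comp mD fD (fun i => \sum_(0 <= k < M) phi k i *: x k))//.
  under eq_bigr do rewrite scaler_sumr.
  rewrite exchange_big/=; apply: eq_bigr => k _; rewrite scaler_suml.
  by apply: eq_bigr => i _; rewrite scalerA.
rewrite (integral_finite_map mD fD (g := fun i => rnorm (phi k i)))//; last first.
  by move=> i; exact: rnorm_ge0.
rewrite lee_fin (le_trans (ler_rnorm_sum _ _ _))//; apply: ler_sum => i _.
by rewrite rnormM rnormc_real ger0_norm// fibre_weight_ge0.
Qed.

End SimpleIntegralFacts.

Section WeightedIntegrals.
Variable (R : realType).
Local Notation leb := (@lebesgue_measure R).

Lemma itv_measure_lty (t : R) : (leb `[0%R, t] < +oo)%E.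
Proof. by rewrite /= lebesgue_measure_itv/= lte_fin; case: ifP => // _; rewrite ltry. Qed.

Variables (t : R) (u : R -> R[i]^o) (N : set R) (v : nat -> R -> R[i]^o) (L : R).
Hypotheses (t0 : 0 <= t) (mN : measurable N) (N0 : leb N = 0%E).
Hypothesis hv : forall m, finite_measurable_map (v m).
Hypothesis vL : forall m s, rnorm (v m s) <= L.
Hypothesis vu : forall s, `[0, t]%classic s -> ~ N s -> v m s @[m --> \oo] --> u s.

(** Carries load estimates for [u] over to its simple approximants. Off [N] everything is a limit of
    simple functions and dominated by G L. *)
Lemma weighted_integral_cvg (g : R -> R) (G : R) : continuous g ->
  (forall s, 0 <= s <= t -> 0 <= g s <= G) ->
  (\int[leb]_(s in `[0%R, t]) (g (grid_point t m s) * rnorm (v m s))%:E)%E @[m --> \oo]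
    --> (\int[leb]_(s in `[0%R, t]) (g s * rnorm (u s))%:E)%E.
Proof.
move=> gc gG.
have mD : measurable (`[0%R, t]%classic : set R) by exact: measurable_itv.
have mDN : measurable (`[0%R, t] `\` N) by exact: measurableD.
have g0 s : 0 <= s <= t -> 0 <= g s by move=> /gG/andP[].
have gp m s : 0 <= g (grid_point t m s) by apply: g0; exact: grid_point_itv.
rewrite (@ge0_integral_setD_null _ _ _ leb _ N)//; last first.
  by move=> s; rewrite /= in_itv/= => st; rewrite lee_fin mulr_ge0 ?rnorm_ge0 ?g0.
have e m : (\int[leb]_(s in `[0%R, t]) (g (grid_point t m s) * rnorm (v m s))%:E =
   \int[leb]_(s in `[0%R, t] `\` N) (g (grid_point t m s) * rnorm (v m s))%:E)%E.
  by apply: ge0_integral_setD_null => // s _; rewrite lee_fin mulr_ge0 ?rnorm_ge0.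
under eq_fun do rewrite e.
have mf m : measurable_fun (`[0%R, t] `\` N)
    (fun s => (g (grid_point t m s) * rnorm (v m s))%:E).
  apply: measurable_funTS.
  exact: (finite_map_measurable
    (fun p : R[i]^o * nat => (g (p.2%:R / m.+1%:R) * rnorm p.1)%:E)
    (finite_measurable_pair (hv m) (grid_index_finite m t0))).
have cf s : (`[0%R, t] `\` N) s -> (g (grid_point t m s) * rnorm (v m s))%:E
    @[m --> \oo] --> (g s * rnorm (u s))%:E.
  move=> [st Ns]; apply: cvg_EFin; first exact: nearW.
  apply: cvgM; last by apply: cvg_rnorm; exact: vu.
  have gpc : grid_point t m s @[m --> \oo] --> s.
    by apply: grid_point_cvg; move: st; rewrite /= in_itv.
  exact: (cvg_comp _ _ gpc (gc s)).
have mfu : measurable_fun (`[0%R, t] `\` N) (fun s => (g s * rnorm (u s))%:E).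
  apply: (@emeasurable_fun_cvg _ _ _ _
    (fun m s => (g (grid_point t m s) * rnorm (v m s))%:E)) => //.
have := @dominated_convergence _ _ _ leb (`[0%R, t] `\` N) mDN
    (fun m s => (g (grid_point t m s) * rnorm (v m s))%:E)
    (fun s => (g s * rnorm (u s))%:E) (cst (G * L)%:E) mf mfu.
case => //.
- by apply: aeW => s Ds; exact: cf.
- apply/integrableP; split; first exact: measurable_cst.
  rewrite integral_cst//= lte_mul_pinfty//.
  rewrite (le_lt_trans _ (itv_measure_lty t))//; apply: le_measure; rewrite ?inE//.
- apply: aeW => s m _.
  rewrite gee0_abs ?lee_fin ?mulr_ge0 ?rnorm_ge0// ler_pM ?rnorm_ge0//.
  by have /andP[] := gG _ (grid_point_itv m s t0).
Qed.

Lemma measurable_rnorm_input : measurable_fun (`[0%R, t] `\` N) (fun s => rnorm (u s)).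
Proof.
apply: (@measurable_fun_cvg _ _ _ _ (fun m s => rnorm (v m s))).
  move=> m; apply: measurable_funTS.
  exact: (finite_map_measurable (fun z : R[i]^o => rnorm z) (hv m)).
by move=> s [st Ns]; apply: cvg_rnorm; exact: vu.
Qed.

Lemma weighted_integral_le (g : R -> R) (C : R) : measurable_fun setT g -> 0 <= C ->
  (forall s, 0 <= s <= t -> 0 <= g s) ->
  (forall s, `[0, t]%classic s -> ~ N s -> rnorm (u s) <= C) ->
  (\int[leb]_(s in `[0%R, t]) (g s * rnorm (u s))%:E <=
     C%:E * \int[leb]_(s in `[0%R, t]) (g s)%:E)%E.
Proof.
move=> mg C0 g0 uC.
have mD : measurable (`[0%R, t]%classic : set R) by exact: measurable_itv.
have mDN : measurable (`[0%R, t] `\` N) by exact: measurableD.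
have g0' s : `[0%R, t]%classic s -> 0 <= g s by rewrite /= in_itv; exact: g0.
rewrite (@ge0_integral_setD_null _ _ _ leb _ N)//; last first.
  by move=> s st; rewrite lee_fin mulr_ge0 ?rnorm_ge0 ?g0'.
rewrite [in leRHS](@ge0_integral_setD_null _ _ _ leb _ N)//.
have mg' : measurable_fun (`[0%R, t] `\` N) (fun s => (g s)%:E).
  by apply/measurable_EFinP; exact: measurable_funTS.
rewrite -ge0_integralZl_EFin//; last by move=> s [st _]; rewrite lee_fin g0'.
apply: ge0_le_integral => //.
- by move=> s [st _]; rewrite lee_fin mulr_ge0 ?rnorm_ge0 ?g0'.
- apply/measurable_EFinP; apply: measurable_funM; last exact: measurable_rnorm_input.
  exact: measurable_funTS.
- by apply: measurable_funeM.
- by move=> s [st Ns]; rewrite -EFinM lee_fin mulrC ler_wpM2r ?g0' ?uC.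
Qed.

End WeightedIntegrals.

(** * Estimates for the single modes *)

Section ModalLoads.
Variable (R : realType).
Local Notation leb := (@lebesgue_measure R).
Variables (lambda : nat -> R[i]) (kappa : nat -> R).

(* [- Re (lambda n)] times a bound for the response of the [n]-th mode to [u];
   [rho s] is [t - s] for the mild solution and [s] for admissibility. *)
Definition modal_load (t : R) (rho : R -> R) (u : R -> R[i]^o) (n : nat) : \bar R :=
  (\int[leb]_(s in `[0%R, t])
    ((- complex.Re (lambda n)) * expR (complex.Re (lambda n) * rho s) * rnorm (u s))%:E)%E.

Lemma modal_weight_continuous (rho : R -> R) n : continuous rho ->
  continuous (fun s => - complex.Re (lambda n) * expR (complex.Re (lambda n) * rho s)).
Proof.
move=> crho s; apply: cvgMl_tmp.
apply: (@continuous_comp _ _ _ (fun s => complex.Re (lambda n) * rho s) expR).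
  by apply: cvgMl_tmp; exact: crho.
exact: continuous_expR.
Qed.

Hypotheses (hneg : forall n, complex.Re (lambda n) < 0).
Hypotheses (k1 : forall n, 1 <= kappa n).
Let r n := - complex.Re (lambda n).
Let r0 n : 0 < r n. Proof. by rewrite oppr_gt0. Qed.
Let kk0 n : 1 <= kappa n ^+ 2. Proof. by rewrite exprn_ege1. Qed.

Variables (t : R) (rho : R -> R) (u : R -> R[i]^o).
Hypotheses (t0 : 0 <= t) (rho0 : forall s, 0 <= s <= t -> 0 <= rho s).
Hypotheses (crho : continuous rho) (hu : Linf t u).
Hypothesis int1 : forall n, (\int[leb]_(s in `[0%R, t])
    (r n * expR (complex.Re (lambda n) * rho s))%:E <= 1)%E.

Let mD : measurable (`[0%R, t]%classic : set R). Proof. exact: measurable_itv. Qed.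
Let Lu0 : 0 <= Linf_norm t u. Proof. by rewrite fine_ge0// Linf_enorm_ge0. Qed.
Let gc n : continuous (fun s => r n * expR (complex.Re (lambda n) * rho s)).
Proof. exact: modal_weight_continuous. Qed.
Let g0 n s : 0 <= r n * expR (complex.Re (lambda n) * rho s).
Proof. by rewrite mulr_ge0 ?expR_ge0 ?(ltW (r0 n)). Qed.

Let modal_load_le_integral n : (modal_load t rho u n <=
  (Linf_norm t u)%:E * \int[leb]_(s in `[0%R, t])
    (r n * expR (complex.Re (lambda n) * rho s))%:E)%E.
Proof.
have [N [v [mN N0 hv vL uv]]] := Linf_approx hu.
have vu s : `[0, t]%classic s -> ~ N s -> v m s @[m --> \oo] --> u s.
  by move=> st Ns; have [] := uv s st Ns.
apply: (@weighted_integral_le R t u N v mN N0 hv vu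
  (fun s => r n * expR (complex.Re (lambda n) * rho s)) (Linf_norm t u)
  (continuous_measurable_fun (@gc n)) Lu0 (fun s _ => g0 n s)).
by move=> s st Ns; have [] := uv s st Ns.
Qed.

Lemma modal_load_le_norm n : (modal_load t rho u n <= (Linf_norm t u)%:E)%E.
Proof.
apply: (le_trans (modal_load_le_integral n)).
by rewrite -[leRHS]mule1 lee_wpmul2l// lee_fin.
Qed.

(** Dropping the exponential loses uniformity in n but gains the factor [t] that zero-class
    admissibility needs. *)
Lemma modal_load_le_rate n : (modal_load t rho u n <= (Linf_norm t u * (r n * t))%:E)%E.
Proof.
apply: (le_trans (modal_load_le_integral n)); rewrite EFinM lee_wpmul2l ?lee_fin//.
apply: (@le_trans _ _ (\int[leb]_(s in `[0%R, t]) (cst (r n)%:E s))%E).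
  apply: ge0_le_integral => //.
  - by move=> s _; rewrite lee_fin.
  - by apply/measurable_EFinP/measurable_funTS; exact: continuous_measurable_fun.
  - move=> s; rewrite /= in_itv/= => st; rewrite lee_fin ler_piMr ?(ltW (r0 n))//.
    by rewrite -expR0 ler_expR mulr_le0_ge0 ?rho0 ?(ltW (hneg n)).
rewrite integral_cst//= lebesgue_measure_itv/= lte_fin.
move: t0; rewrite le_eqVlt => /predU1P[<-|tp]; first by rewrite ltxx mule0 mulr0.
by rewrite tp oppr0 adde0.
Qed.

Lemma modal_load_le_gain (mu : R -> R) (d C : R) : continuous mu ->
  (forall x y, 0 <= x -> x <= y -> mu x <= mu y) -> (forall x, 0 <= x -> 0 <= mu x) ->
  0 < d -> 0 <= C ->
  (forall n z, 0 <= z -> d * kappa n ^+ 2 < z -> r n * z <= C * mu z) -> forall n,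
  (modal_load t rho u n <=
    (kappa n ^+ 2 * (d + C * Rintegral leb `[0%R, t] (fun s => mu (rnorm (u s)))))%:E)%E.
Proof.
move=> cmu mono mu0 d0 C0 hC n.
have [N [v [mN N0 hv vL uv]]] := Linf_approx hu.
have vu s : `[0, t]%classic s -> ~ N s -> v m s @[m --> \oo] --> u s.
  by move=> st Ns; have [] := uv s st Ns.
have mDN : measurable (`[0%R, t] `\` N) by exact: measurableD.
have mru := measurable_rnorm_input hv vu.
have mmu : measurable_fun (`[0%R, t] `\` N) (fun s => (mu (rnorm (u s)))%:E).
  apply/measurable_EFinP.
  exact: (measurableT_comp (continuous_measurable_fun cmu) mru).
have mg : measurable_fun (`[0%R, t] `\` N)
    (fun s => (r n * expR (complex.Re (lambda n) * rho s))%:E).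
  by apply/measurable_EFinP/measurable_funTS; exact: continuous_measurable_fun.
have mup s : (0 <= (mu (rnorm (u s)))%:E)%E by rewrite lee_fin mu0// rnorm_ge0.
pose I0 := (\int[leb]_(s in `[0%R, t]) (mu (rnorm (u s)))%:E)%E.
have I0E : I0 = (\int[leb]_(s in `[0%R, t] `\` N) (mu (rnorm (u s)))%:E)%E.
  exact: ge0_integral_setD_null.
have lDN : (leb (`[0%R, t] `\` N) < +oo)%E.
  rewrite (le_lt_trans _ (itv_measure_lty t))//; apply: le_measure; rewrite ?inE//.
(* [Rintegral] takes the value 0 for an infinite integral, so finiteness has to be checked: off [N]
   the integrand is at most [mu] of the norm of [u]. *)
have I0fin : I0 = (Rintegral leb `[0%R, t] (fun s => mu (rnorm (u s))))%:E.
  rewrite /Rintegral -/I0 fineK// ge0_fin_numE; last exact: integral_ge0.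
  rewrite I0E.
  apply: (@le_lt_trans _ _ (\int[leb]_(s in `[0%R, t] `\` N)
     (cst (mu (Linf_norm t u))%:E s))%E).
    apply: ge0_le_integral => //.
    by move=> s [st Ns]; rewrite lee_fin mono ?rnorm_ge0//; have [] := uv s st Ns.
  by rewrite integral_cst//= lte_mul_pinfty// lee_fin mu0.
have k0 : 0 <= kappa n ^+ 2 by rewrite (le_trans _ (kk0 n)).
have dk0 : 0 <= d * kappa n ^+ 2 by rewrite mulr_ge0// ltW.
rewrite /modal_load (@ge0_integral_setD_null _ _ _ leb _ N)//; last first.
  by move=> s _; rewrite lee_fin (mulr_ge0 (g0 n s) (rnorm_ge0 (u s))).
apply: (@le_trans _ _ (\int[leb]_(s in `[0%R, t] `\` N)
   ((d * kappa n ^+ 2)%:E * (r n * expR (complex.Re (lambda n) * rho s))%:E +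
    C%:E * (mu (rnorm (u s)))%:E))%E).
  apply: ge0_le_integral => //.
  - by move=> s _; rewrite lee_fin (mulr_ge0 (g0 n s) (rnorm_ge0 (u s))).
  - apply/measurable_EFinP; apply: measurable_funM => //.
    by apply/measurable_EFinP; exact: mg.
  - by apply: emeasurable_funD; exact: measurable_funeM.
  - move=> s [st Ns]; rewrite -!EFinM -EFinD lee_fin.
    have rs : 0 <= rho s by apply: rho0; move: st; rewrite /= in_itv.
    have e1 : expR (complex.Re (lambda n) * rho s) <= 1.
      by rewrite -expR0 ler_expR mulr_le0_ge0// ltW.
    have m0 := mu0 _ (rnorm_ge0 (u s)).
    (* Small inputs are paid for by the exponential kernel, whose mass is at most 1; for large ones
       the exponential is dropped and the gain absorbs r_n |u(s)|. *)
    have [h|h] := leP (rnorm (u s)) (d * kappa n ^+ 2).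
      rewrite (@le_trans _ _ (d * kappa n ^+ 2 * (r n * expR (complex.Re (lambda n) * rho s))))//.
        by rewrite mulrC; exact: (ler_wpM2r (g0 n s) h).
      by rewrite lerDl mulr_ge0.
    rewrite (@le_trans _ _ (r n * rnorm (u s)))//.
      by rewrite -mulrA ler_wpM2l ?(ltW (r0 n))// ler_piMl// rnorm_ge0.
    by rewrite (le_trans (hC n _ (rnorm_ge0 _) h))// lerDr mulr_ge0.
rewrite ge0_integralD//; first last.
- exact: measurable_funeM.
- by move=> s _; rewrite mule_ge0// lee_fin.
- exact: measurable_funeM.
- by move=> s _; rewrite mule_ge0// lee_fin.
rewrite ge0_integralZl_EFin//; last by move=> s _; rewrite lee_fin.
rewrite ge0_integralZl_EFin// -I0E I0fin mulrDr EFinD leeD//.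
  rewrite mulrC -[leRHS]mule1 lee_wpmul2l//; first by rewrite lee_fin mulrC.
  apply: le_trans (int1 n); rewrite -(@ge0_integral_setD_null _ _ _ leb _ N)//.
  by move=> s _; rewrite lee_fin.
rewrite -EFinM lee_fin ler_peMl// mulr_ge0//.
by rewrite -lee_fin -I0fin; exact: integral_ge0.
Qed.

End ModalLoads.

(** * The extrapolation space *)

Section Resolvent.
Variables (R : realType) (X : normedModType R[i]) (A : operator X) (beta : R[i]).
Hypothesis hbeta : resolvent_set A beta.

Lemma resolventP x :
  dom A (resolvent A beta x) /\ beta *: resolvent A beta x - A (resolvent A beta x) = x.
Proof.
have [[_ _ surj] _] := hbeta.
have [y Ay yx] := surj x I.
by apply: (@xgetPex X 0 [set y | dom A y /\ beta *: y - A y = x]); exists y.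
Qed.

Lemma resolvent_eigenvector (l : R[i]) (e : X) : eigenpair A l e ->
  resolvent A beta ((beta - l) *: e) = e.
Proof.
move=> [de _ Ae]; have [[_ inj _] _] := hbeta.
have [dr hr] := resolventP ((beta - l) *: e).
apply: inj; rewrite ?inE//.
by rewrite hr Ae scalerBl.
Qed.

Lemma resolvent_eq0 x : resolvent A beta x = 0 -> x = 0.
Proof.
have [_ [lR _]] := hbeta.
move=> x0; have [_ h] := resolventP x; have [_ h0] := resolventP 0.
by rewrite -h x0 -[in LHS](linearf0 lR) h0.
Qed.

End Resolvent.

Section Extrapolation.
Variables (R : realType) (X Xm1 : completeNormedModType R[i]).
Variables (q : R) (e : nat -> X) (A : operator X) (T : R -> X -> X).
Variables (lambda : nat -> R[i]) (beta : R[i]) (j : X -> Xm1) (Tm1 : R -> Xm1 -> Xm1).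
Hypotheses (hq : 1 <= q) (he : q_riesz_basis q e).
Hypotheses (hT : C0_semigroup T) (hA : generates A T).
Hypotheses (hlambda : forall n, eigenpair A (lambda n) (e n)).
Hypotheses (hneg : forall n, complex.Re (lambda n) < 0).
Hypotheses (hbeta : resolvent_set A beta).
Hypotheses (hj : is_extrapolation_space A beta j) (hTm1 : is_extension j T Tm1).

Let lj : linear j. Proof. by case: hj. Qed.
Let lR : linear (resolvent A beta). Proof. by have [_ []] := hbeta. Qed.

Lemma extrapolation_bounded : exists2 M, 0 <= M & forall x, rnorm (j x) <= M * rnorm x.
Proof.
have [_ [_ [M hM]]] := hbeta; have [_ jn _] := hj.
exists `|M| => // x; rewrite jn (le_trans (hM x))// ler_wpM2r ?rnorm_ge0//.
exact: ler_norm.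
Qed.

Lemma extrapolation_inj : injective j.
Proof.
move=> x y jxy; apply/eqP; rewrite -subr_eq0; apply/eqP/(resolvent_eq0 hbeta)/eqP.
have [_ jn _] := hj.
by rewrite -rnorm_eq0 -jn (linearfB _ _ lj) jxy subrr rnorm0.
Qed.

(** On an eigenvector the resolvent divides by beta - lambda_k, which cancels the factor. Windows in
    the extrapolation space are thus measured by windows in X. *)
Lemma extrapolation_norm_basis (a : nat -> R[i]) m n :
  rnorm (j (\sum_(m <= k < n) ((beta - lambda k) * a k) *: e k)) =
  rnorm (\sum_(m <= k < n) a k *: e k).
Proof.
have [_ jn _] := hj; rewrite jn (linearf_sum _ _ _ lR); congr rnorm.
apply: eq_bigr => k _; rewrite mulrC -scalerA (linearfZ _ _ lR).
by rewrite (resolvent_eigenvector hbeta (hlambda k)).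
Qed.

(** By density [b] is a limit of vectors of X, whose resolvents are Cauchy in X. Their limit plays
    the role of the extrapolated resolvent applied to [b], and [zeta] is its basis expansion; no
    extrapolated generator is constructed. *)
Lemma extrapolation_coordinates (b : Xm1) :
  exists zeta : nat -> R[i], cvgn (series (fun k => zeta k *: e k)) /\
    j (\sum_(0 <= k < n) ((beta - lambda k) * zeta k) *: e k) @[n --> \oo] --> b.
Proof.
have [_ jn jd] := hj.
have /choice[x hx] : forall n, exists x, rnorm (b - j x) < n.+1%:R^-1.
  move=> n; have n0 : (0 : R[i]) < (n.+1%:R^-1 : R)%:C by rewrite ltcR invr_gt0.
  have [||y [hb [x _ xy]]] := jd (ball b ((n.+1%:R^-1 : R)%:C)).
  - by exists b; exact: ballxx.
  - exact: ball_open.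
  by exists x; move: hb; rewrite -xy -ball_normE /= rnormE ltcR.
have jx : j (x n) @[n --> \oo] --> b.
  apply: (squeeze_rnorm _ (@cvg_harmonic R)); apply: nearW => n.
  by rewrite rnormB ltW.
have jR m n : rnorm (resolvent A beta (x m) - resolvent A beta (x n)) =
    rnorm (j (x m) - j (x n)).
  by rewrite -(linearfB _ _ lR) -(linearfB _ _ lj) jn.
have cR : cvgn (fun n => resolvent A beta (x n)).
  apply: rnorm_cauchy_cvg => eps eps0; have e20 : 0 < eps / 2 by lra.
  have [N hN] := cvg0_nat ((cvg_rnormP _ _).1 jx) e20.
  exists N => m n /hN hm /hN hn; rewrite jR (le_lt_trans (ler_rdistD b _ _))//.
  rewrite !ger0_norm ?rnorm_ge0// in hm hn.
  by rewrite (splitr eps) ltrD// rnormB.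
have [zeta [hz _]] := he.1 (limn (fun n => resolvent A beta (x n))).
exists zeta; split; first by apply/cvg_ex; eexists; exact: hz.
apply/cvg_rnormP.
(* Both norms are limits of the same sequence, obtained by replacing [b] with its approximants from
   X. *)
have h N : rnorm (j (\sum_(0 <= k < N) ((beta - lambda k) * zeta k) *: e k) - b) =
   rnorm (series (fun k => zeta k *: e k) N - limn (fun n => resolvent A beta (x n))).
  set S := \sum_(0 <= k < N) _.
  have h1 : rnorm (j S - j (x n)) @[n --> \oo] --> rnorm (j S - b).
    by apply: cvg_rnorm; apply: cvgB => //; exact: cvg_cst.
  have h2 : rnorm (j S - j (x n)) @[n --> \oo] -->
      rnorm (series (fun k => zeta k *: e k) N - limn (fun n => resolvent A beta (x n))).
    have -> : (fun n => rnorm (j S - j (x n))) = (fun n => rnorm (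
       series (fun k => zeta k *: e k) N - resolvent A beta (x n))).
      apply/funext => n; rewrite -(linearfB _ _ lj) jn (linearfB _ _ lR).
      rewrite /S (linearf_sum _ _ _ lR) /series/=; congr (rnorm (_ - _)).
      apply: eq_bigr => k _; rewrite mulrC -scalerA (linearfZ _ _ lR).
      by rewrite (resolvent_eigenvector hbeta (hlambda k)).
    by apply: cvg_rnorm; apply: cvgB => //; exact: cvg_cst.
  exact: (cvg_unique _ h1 h2).
under eq_fun do rewrite h.
by apply/cvg_rnormP.
Qed.

Section Kernel.
Variables (b : Xm1) (zeta : nat -> R[i]).
Hypothesis (cz : cvgn (series (fun k => zeta k *: e k))).
Hypothesis (bz : j (\sum_(0 <= k < n) ((beta - lambda k) * zeta k) *: e k)
  @[n --> \oo] --> b).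

Definition orbit_partial_sum (n : nat) (s : R) : X :=
  \sum_(0 <= k < n) (cexpt (lambda k) s * ((beta - lambda k) * zeta k)) *: e k.

Lemma semigroup_partial_sum n s : 0 <= s ->
  T s (\sum_(0 <= k < n) ((beta - lambda k) * zeta k) *: e k) = orbit_partial_sum n s.
Proof.
move=> s0; have [bT _ _ _] := hT; have [lT _] := bT s s0.
rewrite (linearf_sum _ _ _ lT); apply: eq_bigr => k _.
by rewrite (linearfZ _ _ lT) (semigroup_eigenvector hT hA (hlambda k))// scalerA mulrC.
Qed.

Lemma orbit_partial_sum_cvg s : 0 <= s ->
  j (orbit_partial_sum n s) @[n --> \oo] --> Tm1 s b.
Proof.
move=> s0; have [[bT _ _ _] ext] := hTm1; have [lT [M hM]] := bT s s0.
have e1 : (fun n => j (orbit_partial_sum n s)) =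
   (fun n => Tm1 s (j (\sum_(0 <= k < n) ((beta - lambda k) * zeta k) *: e k))).
  by apply/funext => n; rewrite ext// semigroup_partial_sum.
rewrite e1; apply: (@squeeze_rnorm _ _ _ _ _ _ _ (fun n => M * rnorm
  (j (\sum_(0 <= k < n) ((beta - lambda k) * zeta k) *: e k) - b))).
  by apply: nearW => n; rewrite -(linearfB _ _ lT).
by rewrite -(mulr0 M); apply: cvgMl_tmp; exact/cvg_rnormP.
Qed.

Lemma cexpt_le1 n s : 0 <= s -> rnorm (cexpt (lambda n) s) <= 1.
Proof.
by move=> s0; rewrite rnorm_cexpt -expR0 ler_expR mulr_le0_ge0// ltW.
Qed.

(** Uniformity in s comes from |exp(lambda_k s)| <= 1: the multiplier inequality bounds every window
    of the orbit by the same window of [zeta]. *)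
Lemma orbit_partial_sum_approx eps : 0 < eps -> exists N, forall n s, (N <= n)%N -> 0 <= s ->
  rnorm (Tm1 s b - j (orbit_partial_sum n s)) <= eps.
Proof.
move=> eps0; have [K K0 hK] := riesz_multiplier hq he.
have /cvg_ex[z hz] := cz.
have e20 : 0 < eps / K / 2 by rewrite !divr_gt0.
have [N hN] := cvg0_nat ((cvg_rnormP _ _).1 hz) e20.
exists N => n s Nn s0.
have h : rnorm (j (orbit_partial_sum m s) - j (orbit_partial_sum n s)) @[m --> \oo] -->
    rnorm (Tm1 s b - j (orbit_partial_sum n s)).
  by apply: cvg_rnorm; apply: cvgB; [exact: orbit_partial_sum_cvg | exact: cvg_cst].
apply: (cvg_le_bound h); exists n => // m /= nm.
rewrite -(linearfB _ _ lj) /orbit_partial_sum (big_cat_nat (n := n))//= addrAC subrr add0r.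
under eq_bigr do rewrite mulrCA.
rewrite extrapolation_norm_basis.
apply: (le_trans (hK zeta _ 1 n m ler01 _)).
  by move=> i _; rewrite rnormM ler_wpM2r ?rnorm_ge0// cexpt_le1.
rewrite mulr1 -ler_pdivlMl// mulrC.
have -> : \sum_(n <= i < m) zeta i *: e i =
   (series (fun k => zeta k *: e k) m - z) - (series (fun k => zeta k *: e k) n - z).
  by rewrite opprB addrA subrK /series/= (big_cat_nat (m := 0%N) (n := n) (p := m))//=
    addrAC subrr add0r.
rewrite (le_trans (ler_rnormB _ _))// (splitr (eps / K)).
have := hN m (leq_trans Nn nm); have := hN n Nn.
by rewrite !ger0_norm ?rnorm_ge0// => h1 h2; rewrite lerD// ltW.
Qed.

Lemma orbit_partial_sum_bounded n : exists M, forall s, 0 <= s ->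
  rnorm (orbit_partial_sum n s) <= M.
Proof.
exists (\sum_(0 <= k < n) rnorm ((beta - lambda k) * zeta k) * rnorm (e k)) => s s0.
rewrite (le_trans (ler_rnorm_sum _ _ _))//; apply: ler_sum => k _.
rewrite rnormZ rnormM -mulrA ler_piMl ?mulr_ge0 ?rnorm_ge0//.
exact: cexpt_le1.
Qed.

Lemma orbit_bounded : exists M, forall s, 0 <= s -> rnorm (Tm1 s b) <= M.
Proof.
have [N hN] := orbit_partial_sum_approx ltr01.
have [M hM] := orbit_partial_sum_bounded N; have [J J0 hJ] := extrapolation_bounded.
exists (1 + J * M) => s s0.
rewrite -[Tm1 s b](subrK (j (orbit_partial_sum N s))) (le_trans (ler_rnormD _ _))//.
by rewrite lerD// ?hN// (le_trans (hJ _))// ler_wpM2l// hM.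
Qed.

Lemma orbit_partial_sum_continuous n (s : R) (x : nat -> R) : x m @[m --> \oo] --> s ->
  orbit_partial_sum n (x m) @[m --> \oo] --> orbit_partial_sum n s.
Proof.
move=> xs.
pose g k m := rnorm (cexpt (lambda k) (x m) - cexpt (lambda k) s) *
    (rnorm ((beta - lambda k) * zeta k) * rnorm (e k)).
have g0 k : g k m @[m --> \oo] --> 0.
  rewrite -(mul0r (rnorm ((beta - lambda k) * zeta k) * rnorm (e k))); apply: cvgMr_tmp.
  exact: (cvg_comp _ _ xs (@cexpt_continuous R (lambda k) s)).
have sg0 : \sum_(0 <= k < n) g k m @[m --> \oo] --> 0.
  elim: n => [|n ih].
    rewrite (_ : (fun m => _) = cst 0); first exact: cvg_cst.
    by apply/funext => m; rewrite big_geq.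
  have h2 : \sum_(0 <= k < n) g k m + g n m @[m --> \oo] --> (0 + 0 : R) by exact: cvgD.
  rewrite addr0 in h2.
  apply: (cvg_trans _ h2); apply: near_eq_cvg.
  by apply: nearW => m; rewrite big_nat_recr.
apply: (squeeze_rnorm _ sg0); apply: nearW => m.
rewrite /orbit_partial_sum -sumrB (le_trans (ler_rnorm_sum _ _ _))//.
by apply: ler_sum => k _; rewrite -scalerBl -mulrBl rnormZ [X in X * _ <= _]rnormM /g mulrA.
Qed.

(** The orbit is a uniform limit of the truncated orbits, each of which is a finite sum of
    exponentials and hence continuous. *)
Lemma orbit_continuous (s : R) (x : nat -> R) : 0 <= s -> (forall m, 0 <= x m) ->
  x m @[m --> \oo] --> s -> Tm1 (x m) b @[m --> \oo] --> Tm1 s b.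
Proof.
move=> s0 x0 xs; apply/cvg_rnormP/cvgrPdist_lt => eps eps0.
have e30 : 0 < eps / 4 by rewrite divr_gt0.
have [N /(_ N _ (leqnn _)) hN] := orbit_partial_sum_approx e30.
have [J J0 hJ] := extrapolation_bounded.
have e4 : 0 < eps / 4 / (J + 1) by rewrite divr_gt0// ltr_wpDl.
have cN : orbit_partial_sum N (x m) @[m --> \oo] --> orbit_partial_sum N s.
  exact: orbit_partial_sum_continuous.
have [M hM] := cvg0_nat ((cvg_rnormP _ _).1 cN) e4.
exists M => // m /= /hM; rewrite sub0r normrN !ger0_norm ?rnorm_ge0// => h.
have h1 : rnorm (j (orbit_partial_sum N (x m)) - j (orbit_partial_sum N s)) <= eps / 4.
  rewrite -(linearfB _ _ lj) (le_trans (hJ _))//.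
  rewrite (@le_trans _ _ ((J + 1) * (eps / 4 / (J + 1))))//.
    by rewrite ler_pM// ?rnorm_ge0 ?lerDl// ltW.
  by rewrite mulrC divfK// gt_eqF// ltr_wpDl.
have := ler_rdistD (j (orbit_partial_sum N (x m))) (Tm1 (x m) b) (Tm1 s b).
have := ler_rdistD (j (orbit_partial_sum N s)) (j (orbit_partial_sum N (x m))) (Tm1 s b).
have := hN _ (x0 m); have := hN _ s0; rewrite (rnormB (Tm1 s b)).
move: h1; lra.
Qed.

End Kernel.
End Extrapolation.

(** * Input integrals *)

Section InputIntegral.
Variables (R : realType) (X Xm1 : completeNormedModType R[i]).
Variables (q : R) (e : nat -> X) (A : operator X) (T : R -> X -> X).
Variables (lambda : nat -> R[i]) (beta : R[i]) (j : X -> Xm1) (Tm1 : R -> Xm1 -> Xm1).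
Hypotheses (hq : 1 <= q) (he : q_riesz_basis q e).
Hypotheses (hT : C0_semigroup T) (hA : generates A T).
Hypotheses (hlambda : forall n, eigenpair A (lambda n) (e n)).
Hypotheses (hneg : forall n, complex.Re (lambda n) < 0).
Hypotheses (hbeta : resolvent_set A beta).
Hypotheses (hj : is_extrapolation_space A beta j) (hTm1 : is_extension j T Tm1).
Variables (b : Xm1) (zeta : nat -> R[i]).
Hypothesis (cz : cvgn (series (fun k => zeta k *: e k))).
Hypothesis (bz : j (\sum_(0 <= k < n) ((beta - lambda k) * zeta k) *: e k)
  @[n --> \oo] --> b).
Variables (Cb : R) (kappa : nat -> R).
Hypotheses (Cb0 : 0 <= Cb)
  (hCb : forall n, rnorm (beta - lambda n) <= Cb * - complex.Re (lambda n)).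
Hypotheses (k1 : forall n, 1 <= kappa n)
  (cw : cvgn (series (fun k => ((kappa k ^+ 2)%:C * zeta k) *: e k))).

Local Notation leb := (@lebesgue_measure R).
Let r n := - complex.Re (lambda n).
Let r0 n : 0 < r n. Proof. by rewrite oppr_gt0. Qed.
Let kk0 n : 1 <= kappa n ^+ 2. Proof. by rewrite exprn_ege1. Qed.

Let P n s := orbit_partial_sum e lambda beta zeta n s.

Section FixedInput.
Variables (t : R) (rho : R -> R) (u : R -> R[i]^o).
Variables (N : set R) (v : nat -> R -> R[i]^o) (L : R).
Hypotheses (t0 : 0 <= t) (rho0 : forall s, 0 <= s <= t -> 0 <= rho s)
  (crho : continuous rho).
Hypotheses (mN : measurable N) (N0 : leb N = 0%E).
Hypothesis hv : forall m, finite_measurable_map (v m).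
Hypothesis vL : forall m s, rnorm (v m s) <= L.
Hypothesis vu : forall s, `[0, t]%classic s -> ~ N s -> v m s @[m --> \oo] --> u s.

Let mD : measurable (`[0%R, t]%classic : set R). Proof. exact: measurable_itv. Qed.
Let fD := itv_measure_lty t.
Let Xint m M := simple_integral leb `[0%R, t]
  (fun s => v m s *: P M (rho (grid_point t m s))).

Lemma truncated_integral_cvg : exists x : nat -> X,
  forall M, Xint m M @[m --> \oo] --> x M.
Proof.
suff h : forall M, exists x : X, Xint m M @[m --> \oo] --> x 
  by have [x hx] := @choice _ _ (fun M x => Xint m M @[m --> \oo] --> x) h; exists x.
move=> M; have [C hC] := orbit_partial_sum_bounded e beta hneg zeta M.
have [||w hw _] := @kernel_bochner_integral R X t u (fun s => P M (rho s)) C L N v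
  t0 mN N0 hv vL vu; last by exists w.
  by move=> s st; apply: hC; exact: rho0.
move=> s x st xt xs.
have h : rho (x m) @[m --> \oo] --> rho s .
  exact: (cvg_comp _ _ xs (@crho s)).
rewrite /P; apply: orbit_partial_sum_continuous; exact: h.
Qed.

(** For simple inputs the coordinates of the integral are visible as finite sums, which is why the
    estimates are made here and only afterwards passed to the limit in [m]. *)
Lemma truncated_integral_coordinates m : exists alpha : nat -> R[i],
  (forall M, Xint m M = \sum_(0 <= k < M) (alpha k * ((beta - lambda k) * zeta k)) *: e k) /\
  (forall k, ((rnorm (alpha k))%:E <= \int[leb]_(s in `[0%R, t])
     (expR (complex.Re (lambda k) * rho (grid_point t m s)) * rnorm (v m s))%:E)%E).
Proof.
have hp := finite_measurable_pair (hv m) (grid_index_finite m t0).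
have [alpha [ha1 ha2]] := @simple_integral_combination _ _ R leb _ mD fD X _ _
  (fun k (p : R[i]^o * nat) => (p.1 : R[i]) * cexpt (lambda k) (rho (p.2%:R / m.+1%:R)))
  (fun k => ((beta - lambda k) * zeta k) *: e k) hp.
exists alpha; split => [M|k].
  rewrite (_ : Xint m M = simple_integral leb `[0%R, t] (fun s => \sum_(0 <= k < M)
     (v m s * cexpt (lambda k) (rho (grid_point t m s))) *:
       (((beta - lambda k) * zeta k) *: e k))).
    by rewrite ha1; apply: eq_bigr => k _; rewrite scalerA.
  congr simple_integral; apply/funext => s; rewrite scaler_sumr.
  by apply: eq_bigr => k _; rewrite !scalerA -mulrA.
apply: (le_trans (ha2 k)); rewrite le_eqVlt; apply/orP; left; apply/eqP.
by apply: eq_integral => s _; rewrite rnormM rnorm_cexpt mulrC.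
Qed.

Lemma modal_load_cvg k :
  (\int[leb]_(s in `[0%R, t])
    (r k * expR (complex.Re (lambda k) * rho (grid_point t m s)) * rnorm (v m s))%:E)%E
  @[m --> \oo] --> modal_load lambda t rho u k.
Proof.
apply: (@weighted_integral_cvg R t u N v L t0 mN N0 hv vL vu
  (fun s => r k * expR (complex.Re (lambda k) * rho s)) (r k)).
  exact: modal_weight_continuous.
move=> s st; rewrite mulr_ge0 ?expR_ge0 ?(ltW (r0 k))//= ler_piMr ?(ltW (r0 k))//.
by rewrite -expR0 ler_expR mulr_le0_ge0 ?rho0 ?(ltW (hneg k)).
Qed.

(** The loads of the approximants merely converge to those of [u], whence the slack eps; only
    finitely many modes are treated, so a common [m0] exists. *)
Lemma modal_load_approx E eps M : 0 < eps ->
  (forall n, (modal_load lambda t rho u n <= (kappa n ^+ 2 * E)%:E)%E) ->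
  exists m0, forall m k, (m0 <= m)%N -> (k < M)%N ->
  (\int[leb]_(s in `[0%R, t])
    (r k * expR (complex.Re (lambda k) * rho (grid_point t m s)) * rnorm (v m s))%:E <=
    (kappa k ^+ 2 * (E + eps))%:E)%E.
Proof.
move=> eps0 hE; elim: M => [|M [m0 hm0]]; first by exists 0%N.
have [|m1 hm1] := cvge_lt_near (@modal_load_cvg M) (c := (kappa M ^+ 2 * (E + eps))%:E).
  apply: (le_lt_trans (hE M)); rewrite lte_fin ltr_pM2l ?ltrDl//.
  exact: lt_le_trans (kk0 M).
exists (maxn m0 m1) => m k; rewrite geq_max => /andP[hm hm'].
rewrite ltnS leq_eqVlt => /predU1P[->|kM]; first exact: ltW (hm1 _ hm').
exact: hm0.
Qed.

(** Each coordinate in the window is at most Cb r_k |alpha_k| |zeta_k|, hence at most Cb (E + eps)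
    times the coordinate with weight kappa_k^2. The multiplier inequality compares the two windows,
    and then m tends to infinity and eps to 0. *)
Lemma truncated_integral_bound (x : nat -> X) (K E : R) (M1 M2 : nat) :
  (forall M, Xint m M @[m --> \oo] --> x M) -> 0 <= K -> 0 <= E ->
  (forall (a c : nat -> R[i]) B m n, 0 <= B ->
    (forall i, (m <= i < n)%N -> rnorm (c i) <= B * rnorm (a i)) ->
    rnorm (\sum_(m <= i < n) c i *: e i) <= K * B * rnorm (\sum_(m <= i < n) a i *: e i)) ->
  (forall n, (modal_load lambda t rho u n <= (kappa n ^+ 2 * E)%:E)%E) -> (M1 <= M2)%N ->
  rnorm (x M2 - x M1) <=
    K * (Cb * E) * rnorm (\sum_(M1 <= k < M2) ((kappa k ^+ 2)%:C * zeta k) *: e k).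
Proof.
move=> hx K0 E0 hK hE M12; set W := rnorm (\sum_(M1 <= k < M2) _).
have W0 : 0 <= W by exact: rnorm_ge0.
suff h eps : 0 < eps -> rnorm (x M2 - x M1) <= K * (Cb * (E + eps)) * W.
  apply/ler_addgt0Pr => eps eps0.
  have D0 : 0 < K * Cb * W + 1 by rewrite ltr_wpDl// !mulr_ge0.
  have := h (eps / (K * Cb * W + 1)); rewrite divr_gt0// => /(_ isT)/le_trans; apply.
  rewrite (_ : _ * W = K * (Cb * E) * W + K * Cb * W / (K * Cb * W + 1) * eps); last by ring.
  rewrite lerD2l ler_piMl ?(ltW eps0)// ler_pdivrMr// mul1r lerDl//.
move=> eps0.
have hlim : rnorm (Xint m M2 - Xint m M1) @[m --> \oo] --> rnorm (x M2 - x M1).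
  by apply: cvg_rnorm; apply: cvgB; exact: hx.
have [m0 hm0] := @modal_load_approx E eps M2 eps0 hE.
apply: (cvg_le_bound hlim); exists m0 => // m /= mm0.
have [alpha [ha1 ha2]] := truncated_integral_coordinates m.
rewrite !ha1 (big_cat_nat (m := 0%N) (n := M1) (p := M2))//= addrAC subrr add0r.
apply: hK; first by rewrite mulr_ge0// addr_ge0// ltW.
move=> k /andP[_ kM2].
have ak : r k * rnorm (alpha k) <= kappa k ^+ 2 * (E + eps).
  rewrite -lee_fin; apply: le_trans (hm0 m k mm0 kM2).
  under eq_integral do rewrite -mulrA EFinM.
  rewrite ge0_integralZl_EFin ?(ltW (r0 k))//.
  - by rewrite EFinM lee_wpmul2l ?lee_fin ?(ltW (r0 k)).
  - by move=> s _; rewrite lee_fin mulr_ge0 ?expR_ge0 ?rnorm_ge0.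
  - apply: measurable_funTS.
    exact: (finite_map_measurable (fun p : R[i]^o * nat =>
       (expR (complex.Re (lambda k) * rho (p.2%:R / m.+1%:R)) * rnorm p.1)%:E)
      (finite_measurable_pair (hv m) (grid_index_finite m t0))).
rewrite !rnormM rnormc_real ger0_norm ?exprn_ge0 ?(le_trans _ (k1 k))//.
rewrite !mulrA ler_wpM2r ?rnorm_ge0//.
rewrite (@le_trans _ _ (rnorm (alpha k) * (Cb * r k)))// ?ler_wpM2l ?rnorm_ge0//.
rewrite (_ : _ * _ = Cb * (r k * rnorm (alpha k))); last by ring.
rewrite (_ : _ * kappa k * kappa k = Cb * (kappa k ^+ 2 * (E + eps))); last by ring.
by rewrite ler_wpM2l.
Qed.

(** An interchange of the limits in [m] and [M]: the truncation error of the integral is at most L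
    eps t uniformly in [m], because the orbit is approximated uniformly in time. *)
Lemma truncated_integral_limit (x : nat -> X) (w : Xm1) (y : X) :
  (forall M, Xint m M @[m --> \oo] --> x M) -> x M @[M --> \oo] --> y ->
  simple_integral leb `[0%R, t] (fun s => v m s *: Tm1 (rho (grid_point t m s)) b)
    @[m --> \oo] --> w ->
  w = j y.
Proof.
move=> hx xy hw; have [lj _ _] := hj.
have [J J0 hJ] := extrapolation_bounded hbeta hj.
have jc (F : set_system nat) (FF : ProperFilter F) (z : nat -> X) z' : z @ F --> z' ->
    j (z n) @[n --> F] --> j z'.
  move=> /cvg_rnormP zz; apply: (@squeeze_rnorm _ _ _ _ _ _ _ (fun n => J * rnorm (z n - z'))).
    by apply: nearW => n; rewrite -(linearfB _ _ lj).
  by rewrite -(mulr0 J); apply: cvgMl_tmp.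
have L0 : 0 <= L by rewrite (le_trans _ (vL 0 0))// rnorm_ge0.
have rg m s : 0 <= rho (grid_point t m s) by apply: rho0; exact: grid_point_itv.
have tail eps : 0 < eps -> exists M0, forall M, (M0 <= M)%N ->
    rnorm (w - j (x M)) <= L * eps * t.
  move=> eps0.
  have [M0 hM0] := orbit_partial_sum_approx hq he hT hA hlambda hneg hbeta hj hTm1 cz bz eps0.
  exists M0 => M MM.
  have hlim : rnorm (simple_integral leb `[0%R, t]
        (fun s => v m s *: Tm1 (rho (grid_point t m s)) b) - j (Xint m M))
      @[m --> \oo] --> rnorm (w - j (x M)).
    by apply: cvg_rnorm; apply: cvgB => //; exact: jc.
  apply: (cvg_le_bound hlim); apply: nearW => m.
  have hp := finite_measurable_pair (hv m) (grid_index_finite m t0).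
  have f1 : finite_measurable_map (fun s => v m s *: Tm1 (rho (grid_point t m s)) b).
    exact: (finite_measurable_comp
      (fun p : R[i]^o * nat => p.1 *: Tm1 (rho (p.2%:R / m.+1%:R)) b) hp).
  have f2 : finite_measurable_map (fun s => v m s *: P M (rho (grid_point t m s))).
    exact: (finite_measurable_comp
      (fun p : R[i]^o * nat => p.1 *: P M (rho (p.2%:R / m.+1%:R))) hp).
  have f3 := finite_measurable_comp j f2.
  rewrite -(@simple_integral_linear _ _ R leb _ mD fD _ _ j _ lj f2) -lee_fin.
  apply: (le_trans (@simple_integral_dist _ _ R leb _ mD fD _ _ _ f1 f3)).
  apply: (@le_trans _ _ (\int[leb]_(s in `[0%R, t]) (cst (L * eps)%:E s))%E).
    apply: ge0_le_integral => //.
    - by move=> s _; rewrite lee_fin rnorm_ge0.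
    - apply: measurable_funTS.
      exact: (finite_map_measurable (fun p : Xm1 * Xm1 => (rnorm (p.1 - p.2))%:E)
        (finite_measurable_pair f1 f3)).
    - move=> s _; rewrite lee_fin /= (linearfZ _ _ lj) -scalerBr rnormZ.
      by rewrite ler_pM ?rnorm_ge0// hM0.
  rewrite integral_cst//= lebesgue_measure_itv/= lte_fin.
  move: t0; rewrite le_eqVlt => /predU1P[<-|tp]; first by rewrite ltxx mule0 mulr0.
  by rewrite tp oppr0 adde0.
have jw : j (x M) @[M --> \oo] --> w.
  apply/cvg_rnormP/cvgrPdist_le => eps eps0.
  have D0 : 0 < L * t + 1 by rewrite ltr_wpDl// mulr_ge0.
  have [|M0 hM0] := tail (eps / (L * t + 1)); first by rewrite divr_gt0.
  exists M0 => // M /= /hM0; rewrite sub0r normrN ger0_norm ?rnorm_ge0// rnormB.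
  move/le_trans; apply.
  rewrite (_ : _ * t = L * t / (L * t + 1) * eps); last by ring.
  by rewrite ler_piMl ?(ltW eps0)// ler_pdivrMr// mul1r lerDl.
exact: (cvg_unique _ jw (jc _ _ _ _ xy)).
Qed.

(** [E0] only secures convergence of the truncated integrals. The final bound holds for every [E]
    once [y] is fixed, since an infimum over many such [E] is taken for the same integral. *)
Lemma fixed_input_integral (K W E0 : R) : 0 <= K -> 0 <= E0 ->
  (forall (a c : nat -> R[i]) B m n, 0 <= B ->
    (forall i, (m <= i < n)%N -> rnorm (c i) <= B * rnorm (a i)) ->
    rnorm (\sum_(m <= i < n) c i *: e i) <= K * B * rnorm (\sum_(m <= i < n) a i *: e i)) ->
  (forall n, rnorm (series (fun k => ((kappa k ^+ 2)%:C * zeta k) *: e k) n) <= W) ->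
  (forall n, (modal_load lambda t rho u n <= (kappa n ^+ 2 * E0)%:E)%E) ->
  exists2 y, is_bochner_integral leb `[0%R, t] (fun s => u s *: Tm1 (rho s) b) (j y) &
    forall E, 0 <= E -> (forall n, (modal_load lambda t rho u n <= (kappa n ^+ 2 * E)%:E)%E) ->
      rnorm y <= K * Cb * W * E.
Proof.
move=> K0 E00 hK hW hE0.
have [x hx] := truncated_integral_cvg.
pose S := series (fun k => ((kappa k ^+ 2)%:C * zeta k) *: e k).
have SE m n : (m <= n)%N ->
    \sum_(m <= k < n) ((kappa k ^+ 2)%:C * zeta k) *: e k = S n - S m.
  by move=> mn; rewrite /S /series /= (big_cat_nat (m := 0%N) (n := m) (p := n))//=
    addrAC subrr add0r.
have xS E m n : 0 <= E -> (forall n, (modal_load lambda t rho u n <= (kappa n ^+ 2 * E)%:E)%E) ->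
    (m <= n)%N -> rnorm (x n - x m) <= K * (Cb * E) * rnorm (S n - S m).
  move=> E0' hE mn; rewrite -SE//.
  exact: truncated_integral_bound.
have cx : cvgn x.
  apply: rnorm_cauchy_cvg => eps eps0.
  have /cvg_ex[z hz] := cw.
  have D0 : 0 < K * (Cb * E0) + 1 by rewrite ltr_wpDl// !mulr_ge0.
  have d0 : 0 < eps / (K * (Cb * E0) + 1) / 2 by rewrite !divr_gt0.
  have [M hM] := cvg0_nat ((cvg_rnormP _ _).1 hz) d0.
  have h m n : (M <= m)%N -> (m <= n)%N -> rnorm (x n - x m) < eps.
    move=> Mm mn; have := hM m Mm; have := hM n (leq_trans Mm mn).
    rewrite !ger0_norm ?rnorm_ge0// => h1 h2.
    have h3 : rnorm (S n - S m) < eps / (K * (Cb * E0) + 1).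
      rewrite (le_lt_trans (ler_rdistD z _ _))// (splitr (eps / _)) ltrD//.
      by rewrite rnormB.
    rewrite (le_lt_trans (xS E0 m n E00 hE0 mn))//.
    rewrite (@le_lt_trans _ _ ((K * (Cb * E0) + 1) * rnorm (S n - S m)))//.
      by rewrite ler_wpM2r ?rnorm_ge0// lerDl.
    by rewrite mulrC -ltr_pdivlMr.
  exists M => m n Mm Mn; have [mn|/ltnW nm] := leqP m n; last exact: h.
  by rewrite rnormB; exact: h.
(* The empty truncation vanishes, so the bound on differences becomes a bound on [x n] itself. *)
have x00 : x 0%N = 0.
  have h0 : Xint m 0%N @[m --> \oo] --> (0 : X).
    apply: cvg_near_cst; apply: nearW => m.
    have [alpha [-> _]] := truncated_integral_coordinates m.
    by rewrite big_geq.
  exact: (cvg_unique _ (hx 0%N) h0).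
have [M hM] := orbit_bounded hq he hT hA hlambda hneg hbeta hj hTm1 cz bz.
have [||w hw hb] := @kernel_bochner_integral R Xm1 t u (fun s => Tm1 (rho s) b) M L N v
  t0 mN N0 hv vL vu.
- by move=> s st; apply: hM; exact: rho0.
- move=> s z st zt zs.
  apply: (orbit_continuous hq he hT hA hlambda hneg hbeta hj hTm1 cz bz (rho0 st)).
    by move=> m; exact: rho0.
  exact: (cvg_comp _ _ zs (@crho s)).
have wy := truncated_integral_limit hx cx hw.
exists (limn x); first by rewrite -wy.
move=> E E0' hE; apply: (cvg_le_bound (cvg_rnorm cx)); apply: nearW => n.
have := xS E 0%N n E0' hE (leq0n n); rewrite x00 subr0 => /le_trans; apply.
rewrite (_ : K * Cb * W * E = K * (Cb * E) * W); last by ring.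
rewrite ler_wpM2l ?mulr_ge0//.
by rewrite /S {2}/series/= big_geq// subr0.
Qed.

End FixedInput.

Lemma input_integral_exists : exists2 C : R, 0 <= C &
  forall (t : R) (rho : R -> R) (u : R -> R[i]^o), 0 <= t ->
  (forall s, 0 <= s <= t -> 0 <= rho s) ->
  continuous rho ->
  (forall n, (\int[leb]_(s in `[0%R, t])
    (r n * expR (complex.Re (lambda n) * rho s))%:E <= 1)%E) ->
  Linf t u ->
  exists2 y, is_bochner_integral leb `[0%R, t] (fun s => u s *: Tm1 (rho s) b) (j y) &
    forall E, 0 <= E -> (forall n, (modal_load lambda t rho u n <= (kappa n ^+ 2 * E)%:E)%E) ->
      rnorm y <= C * E.
Proof.
have [K K0 hK] := riesz_multiplier hq he.
have [W W0 hW] := cvg_rnorm_bounded cw.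
(* The factors come from the multiplier inequality, the sector estimate and the weighted expansion;
   none depends on the time, on [rho] or on the input. *)
exists (K * Cb * W); first by rewrite !mulr_ge0 ?(ltW K0) ?(ltW W0).
move=> t rho u t0 rho0 crho int1 hu.
have [N [v [mN N0 hv vL uv]]] := Linf_approx hu.
have vu s : `[0, t]%classic s -> ~ N s -> v m s @[m --> \oo] --> u s.
  by move=> st Ns; have [] := uv s st Ns.
have Lu0 : 0 <= Linf_norm t u by rewrite fine_ge0// Linf_enorm_ge0.
apply: (@fixed_input_integral t rho u N v _ t0 rho0 crho mN N0 hv vL vu K W
  (Linf_norm t u) (ltW K0) Lu0 hK hW).
move=> n; apply: (le_trans (modal_load_le_norm hneg crho hu int1 n)).
by rewrite lee_fin ler_peMl.
Qed.

End InputIntegral.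

Lemma eq_bochner_integral d (T : measurableType d) (R : realType)
    (mu : {measure set T -> \bar R}) (V : normedModType R[i]) (D : set T) (f g : T -> V) y :
  (forall x, D x -> f x = g x) -> is_bochner_integral mu D f y -> is_bochner_integral mu D g y.
Proof.
move=> fg [s [hs [N [mN N0 sN]] si sy]]; exists s; split => //.
  by exists N; split => // x /= nx; apply: sN => /= h; apply: nx => Dx; rewrite -fg//; exact: h.
rewrite (_ : (fun n => _) = (fun n => (\int[mu]_(x in D) (rnorm (f x - s n x))%:E)%E))//.
by apply/funext => n; apply: eq_integral => x; rewrite inE => Dx; rewrite fg.
Qed.

Section ConstantInput.
Variable (R : realType).
Local Notation leb := (@lebesgue_measure R).

Lemma Linf_one (t : R) : 0 < t ->
  Linf t (fun=> 1 : R[i]^o) /\ 0 < Linf_norm t (fun=> 1 : R[i]^o).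
Proof.
move=> t0; pose one := (fun=> 1) : R -> R[i]^o.
have le1 : (Linf_enorm t one <= 1%:E)%E.
  apply/ess_supP; apply: nearW => s; rewrite /patch; case: ifP => _ //.
  by rewrite lee_fin rnorm1.
have fin : (Linf_enorm t one < +oo)%E by rewrite (le_lt_trans le1)// ltry.
split.
  split => //; exists (fun=> one); split; last by apply: aeW => x _; exact: cvg_cst.
  move=> _; apply: (@simple_on_finite _ _ R leb _ _ (itv_measure_lty t)) => //.
  split.
    apply: (@sub_finite_set _ _ [set (1 : R[i]^o)]); last exact: finite_set1.
    by move=> _ [s _ <-].
  move=> i; have [->|i1] := eqVneq i 1.
    by rewrite (_ : _ @^-1` _ = setT)//; apply/seteqP.
  rewrite (_ : _ @^-1` _ = set0)//; apply/seteqP; split => // s /= /eqP.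
  by rewrite eq_sym (negbTE i1).
have pos := Linf_enorm_ge0 t one.
rewrite lt_def fine_ge0// andbT; apply/eqP => n0.
have E0 : Linf_enorm t one = 0%E.
  have n0' : Linf_norm t one = 0 by exact: n0.
  by rewrite -[LHS]fineK ?ge0_fin_numE// -/(Linf_norm t one) n0'.
have [N [mN N0 sN]] : \forall s \ae leb, (((fun s => (rnorm (one s))%:E) \_ `[0%R, t]) s <= 0)%E.
  by apply/ess_supP; rewrite -/(Linf_enorm t one) E0.
have sub : `[0%R, t]%classic `<=` N.
  move=> s st; apply: sN => /=; rewrite /patch mem_set// rnorm1 lee_fin.
  by apply/negP; rewrite -ltNge.
have : (leb `[0%R, t] <= leb N)%E by apply: le_measure; rewrite ?inE.
by rewrite N0 lebesgue_measure_itv/= lte_fin t0 oppr0 adde0 lee_fin leNgt t0.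
Qed.

End ConstantInput.

(** * Decay of the semigroup, sector estimate and the stability properties *)

Section Decay.
Variables (R : realType) (X : completeNormedModType R[i]).
Variables (q : R) (e : nat -> X) (A : operator X) (T : R -> X -> X).
Variables (lambda : nat -> R[i]) (w : R).
Hypotheses (hq : 1 <= q) (he : q_riesz_basis q e).
Hypotheses (hT : C0_semigroup T) (hA : generates A T).
Hypotheses (hlambda : forall n, eigenpair A (lambda n) (e n)).
Hypotheses (hneg : forall n, complex.Re (lambda n) < 0).
Hypotheses (hw : forall n, complex.Re (lambda n) <= - w).

(** On partial sums of the expansion [T t] multiplies coordinates by numbers of modulus at most
    exp(- w t). The multiplier inequality applies, and boundedness of [T t] passes it to the
    limit. *)
Lemma semigroup_decay : exists2 M, 0 < M & forall t x, 0 <= t ->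
  rnorm (T t x) <= M * expR (- w * t) * rnorm x.
Proof.
have [K K0 hK] := riesz_multiplier hq he; exists K => // t x t0.
have [a [ha _]] := he.1 x.
have [bT _ _ _] := hT; have [lT [C hC]] := bT t t0.
have hTS : T t (series (fun k => a k *: e k) n) @[n --> \oo] --> T t x.
  apply: (@squeeze_rnorm _ _ _ _ _ _ _ (fun n => C * rnorm (series (fun k => a k *: e k) n - x))).
    by apply: nearW => n; rewrite -(linearfB _ _ lT).
  by rewrite -(mulr0 C); apply: cvgMl_tmp; exact/cvg_rnormP.
rewrite -subr_ge0; apply: (cvg_ge_bound (F := \oo) (g := fun n =>
   K * expR (- w * t) * rnorm (series (fun k => a k *: e k) n) -
   rnorm (T t (series (fun k => a k *: e k) n)))).
  apply: cvgB; last exact: cvg_rnorm.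
  by apply: cvgMl_tmp; exact: cvg_rnorm.
apply: nearW => n; rewrite subr_ge0 /series /= (linearf_sum _ _ _ lT).
rewrite (eq_bigr (fun k => (cexpt (lambda k) t * a k) *: e k)); last first.
  move=> k _; rewrite (linearfZ _ _ lT) (semigroup_eigenvector hT hA (hlambda k))//.
  by rewrite scalerA mulrC.
apply: hK; first exact: expR_ge0.
move=> k _; rewrite rnormM ler_wpM2r ?rnorm_ge0// rnorm_cexpt ler_expR.
by rewrite ler_wpM2r.
Qed.

End Decay.

Section SectorEstimate.
Variables (R : realType) (lambda : nat -> R[i]) (beta : R[i]).
Hypothesis hsector : in_open_left_sector lambda.
Hypothesis hsup : sup (range (fun n => complex.Re (lambda n))) < 0.

Lemma spectral_gap n :
  complex.Re (lambda n) <= sup (range (fun n => complex.Re (lambda n))).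
Proof.
(* [sup] bounds the range only when some upper bound exists; the left half-plane provides 0. *)
apply: ub_le_sup; last by exists n.
by exists 0 => _ [m _ <-]; rewrite ltW// hsector.1.
Qed.

(** By the gap |beta| is at most (|beta| / w) r_n, and by the sector condition |lambda_n| is at most
    (1 + k) r_n. *)
Lemma sector_estimate : exists2 C, 0 <= C &
  forall n, rnorm (beta - lambda n) <= C * - complex.Re (lambda n).
Proof.
have [hneg [k k0 hk]] := hsector.
set w := - sup (range (fun n => complex.Re (lambda n))).
have w0 : 0 < w by rewrite oppr_gt0.
exists (rnorm beta / w + (1 + k)).
  by rewrite addr_ge0 ?divr_ge0 ?rnorm_ge0 ?(ltW w0)// addr_ge0// ltW.
move=> n; have rw : w <= - complex.Re (lambda n) by rewrite lerN2 spectral_gap.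
rewrite (le_trans (ler_rnormB _ _))// mulrDl lerD//.
  by rewrite mulrAC ler_pdivlMr// ler_wpM2l ?rnorm_ge0.
rewrite (le_trans (rnormc_le _))// mulrDl mul1r.
by have := hk n; rewrite !(ltr0_norm (hneg n)) mulrN lerD2l.
Qed.

End SectorEstimate.

Theorem theorem4p1 (R : realType) (q : R) (hq : 1 <= q)
    (X : completeNormedModType R[i])
    (T : R -> X -> X) (hT : C0_semigroup T)
    (A : operator X) (hA : generates A T)
    (e : nat -> X) (he : q_riesz_basis q e)
    (lambda : nat -> R[i]) (hlambda : forall n, eigenpair A (lambda n) (e n))
    (hsector : in_open_left_sector lambda)
    (hsup : sup (range (fun n => complex.Re (lambda n))) < 0)
    (beta : R[i]) (hbeta : resolvent_set A beta)
    (Xm1 : completeNormedModType R[i]) (j : X -> Xm1)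
    (hj : is_extrapolation_space A beta j)
    (Tm1 : R -> Xm1 -> Xm1) (hTm1 : is_extension j T Tm1)
    (B : R[i]^o -> Xm1) (hB : bounded_linear B) :
  [/\ Linf_iISS T j Tm1 B, Linf_ISS T j Tm1 B
    & Linf_zero_class_admissible j Tm1 B].
Proof.
have hneg := hsector.1.
pose w := - sup (range (fun n => complex.Re (lambda n))).
have w0 : 0 < w by rewrite oppr_gt0.
have hw n : complex.Re (lambda n) <= - w by rewrite opprK; exact: spectral_gap.
have [Cb Cb0 hCb] := sector_estimate beta hsector hsup.
have [M M0 hM] := semigroup_decay hq he hT hA hlambda hneg hw.
have [zeta [cz bz]] := extrapolation_coordinates he hlambda hbeta hj (B 1).
have [kappa [k1 koo cw]] := riesz_weights hq he cz.
have [C C0 hC] := input_integral_exists hq he hT hA hlambda hneg hbeta hj hTm1 cz bz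
  Cb0 hCb k1 cw.
have r0 n : 0 < - complex.Re (lambda n) by rewrite oppr_gt0.
have kk0 n : 1 <= kappa n ^+ 2 by rewrite exprn_ege1.
have [lj _ _] := hj.
have BE s (z : R[i]^o) : 0 <= s -> Tm1 s (B z) = z *: Tm1 s (B 1).
  move=> s0; have [[bT _ _ _] _] := hTm1; have [lT _] := bT s s0.
  by rewrite -[z in LHS](mulr1 z) -[z * 1]/(z *: (1 : R[i]^o)) (linearfZ _ _ hB.1)
    (linearfZ _ _ lT).
have reach (t : R) (rho : R -> R) (u : R -> R[i]^o) : 0 <= t ->
    (forall s, 0 <= s <= t -> 0 <= rho s) -> continuous rho ->
    (forall n, (\int[lebesgue_measure]_(s in `[0%R, t])
      (- complex.Re (lambda n) * expR (complex.Re (lambda n) * rho s))%:E <= 1)%E) ->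
    Linf t u ->
    exists2 y, is_bochner_integral (@lebesgue_measure R) `[0, t]
        (fun s => Tm1 (rho s) (B (u s))) (j y) &
      forall E, 0 <= E ->
        (forall n, (modal_load lambda t rho u n <= (kappa n ^+ 2 * E)%:E)%E) ->
        rnorm y <= C * E.
  move=> t0 rho0 crho int1 hu; have [y hy hE] := hC t rho u t0 rho0 crho int1 hu.
  exists y => //; apply: eq_bochner_integral hy => s; rewrite /= in_itv/= => st.
  by rewrite [RHS]BE// rho0.
have id0 (t : R) s : 0 <= s <= t -> 0 <= id s by move=> /andP[].
have idc : continuous (@id R) by move=> s; exact: cvg_id.
have idi t : 0 <= t -> forall n, (\int[lebesgue_measure]_(s in `[0%R, t])
    (- complex.Re (lambda n) * expR (complex.Re (lambda n) * id s))%:E <= 1)%E.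
  by move=> t0 n; have := integral_expR_forward (r0 n) t0; rewrite opprK.
have bk0 (t : R) s : 0 <= s <= t -> 0 <= t - s by rewrite subr_ge0 => /andP[].
have bkc (t : R) : continuous (fun s : R => t - s).
  by move=> s; apply: cvgB; [exact: cvg_cst | exact: cvg_id].
have bki t : 0 <= t -> forall n, (\int[lebesgue_measure]_(s in `[0%R, t])
    (- complex.Re (lambda n) * expR (complex.Re (lambda n) * (t - s)))%:E <= 1)%E.
  by move=> t0 n; have := integral_expR_backward (r0 n) t0; rewrite opprK.
have Lu0 (t : R) (u : R -> R[i]^o) : 0 <= Linf_norm t u.
  by rewrite fine_ge0// Linf_enorm_ge0.
have le_kappa E n : 0 <= E -> (E%:E <= (kappa n ^+ 2 * E)%:E)%E.
  by move=> E0; rewrite lee_fin ler_peMl.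
pose mu := gain (fun n => - complex.Re (lambda n)) kappa.
have rp n : 0 <= - complex.Re (lambda n) by exact: ltW.
have kp n : 0 <= kappa n by rewrite (le_trans _ (k1 n)).
have Kmu : classK mu by exact: gain_classK.
have cmu : continuous mu by exact: gain_continuous.
have mu0 x : 0 <= x -> 0 <= mu x by have [_ h _ _] := Kmu; exact: h.
have mu_mono x y : 0 <= x -> x <= y -> mu x <= mu y.
  have [_ _ h _] := Kmu => x0; rewrite le_eqVlt => /predU1P[->//|xy].
  by rewrite ltW// h.
have /choice[Cf hCf] : forall d, exists c, 0 < d -> 0 <= c /\
    forall n z, 0 <= z -> d * kappa n ^+ 2 < z -> - complex.Re (lambda n) * z <= c * mu z.
  move=> d; have [d0|d0] := ltP 0 d; last by exists 0.
  by have [c c0 hc] := gain_superlinear rp kp koo d0; exists c.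
split.
- have [theta [Ktheta htheta]] := affine_envelope C0 (fun d d0 => (hCf d d0).1).
  exists (fun s t => M * expR (- w * t) * s), theta, mu; split => //.
    exact: exponential_classKL.
  move=> t x0 u t0 hu.
  have [y hy hE] := reach t _ u t0 (@bk0 t) (bkc t) (bki t t0) hu.
  exists (T t x0 + y).
    by exists (j y) => //; rewrite (linearfD _ _ lj).
  rewrite (le_trans (ler_rnormD _ _))// lerD ?hM//.
  have I0 : 0 <= Rintegral lebesgue_measure `[0, t] (fun s => mu (rnorm (u s))).
    by apply: Rintegral_ge0 => s _; rewrite mu0// rnorm_ge0.
  apply: htheta => // d d0; have [c0 hc] := hCf d d0.
  apply: hE; first by rewrite addr_ge0 ?(ltW d0)// mulr_ge0.
  move=> n; exact: (modal_load_le_gain hneg k1 (@bk0 t) (bkc t) hu (bki t t0)).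
(* Every load is at most the norm of [u], so the gain can be linear; the slope C + 1 is positive
   even if C = 0. *)
- exists (fun s t => M * expR (- w * t) * s), (fun s => (C + 1) * s); split.
  + exact: exponential_classKL.
  + by apply: linear_classKoo; rewrite ltr_wpDl.
  move=> t x0 u t0 hu.
  have [y hy hE] := reach t _ u t0 (@bk0 t) (bkc t) (bki t t0) hu.
  exists (T t x0 + y).
    by exists (j y) => //; rewrite (linearfD _ _ lj).
  rewrite (le_trans (ler_rnormD _ _))// lerD ?hM//.
  apply: (@le_trans _ _ (C * Linf_norm t u)); last by rewrite ler_wpM2r// lerDl.
  apply: hE => // n; apply: le_trans (le_kappa _ n (Lu0 t u)).
  exact: (modal_load_le_norm hneg (bkc t) hu (bki t t0)).
- have adm t u : 0 <= t -> Linf t u -> exists2 y, is_input_integral j Tm1 B t u y &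
      forall E, 0 <= E ->
        (forall n, (modal_load lambda t id u n <= (kappa n ^+ 2 * E)%:E)%E) ->
        rnorm y <= C * E.
    by move=> t0 hu; exact: (reach t id u t0 (@id0 t) idc (idi t t0) hu).
  have uniq t u y z : is_input_integral j Tm1 B t u y -> is_input_integral j Tm1 B t u z ->
      y = z.
    move=> hy hz; apply: (extrapolation_inj hbeta hj).
    apply: (@bochner_integral_unique _ _ R lebesgue_measure `[0%R, t] _ _ _ _ _ _ hy hz).
      exact: measurable_itv.
    exact: itv_measure_lty.
  (* If d kappa_n^2 >= 1, the weight dominates the norm bound of the load. Otherwise the gain
     inequality at the value 1 gives r_n <= C_d mu(1), and the rate bound yields the term with
     [t]. *)
  have bound t d : 0 <= t -> 0 < d ->
      admissibility_bound j Tm1 B t (C * (d + Cf d * mu 1 * t)).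
    move=> t0 d0 u y hu hy; have [z hz hE] := adm t u t0 hu.
    rewrite (uniq t u _ _ hy hz) -mulrA; have [c0 hc] := hCf d d0.
    have B0 : 0 <= Cf d * mu 1 * t by rewrite !mulr_ge0// mu0.
    apply: hE; first by rewrite mulr_ge0// addr_ge0// ltW.
    move=> n; have [dk|dk] := leP 1 (d * kappa n ^+ 2).
      apply: (le_trans (modal_load_le_norm hneg idc hu (idi t t0) n)).
      rewrite lee_fin mulrA ler_peMl// mulrDr (le_trans dk)// mulrC lerDl.
      by rewrite mulr_ge0// (le_trans _ (kk0 n)).
    apply: (le_trans (modal_load_le_rate hneg t0 (@id0 t) idc hu n)).
    rewrite lee_fin mulrC mulrA ler_wpM2r//.
    apply: (@le_trans _ _ (Cf d * mu 1 * t)).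
      by rewrite ler_wpM2r// -[leLHS]mulr1 hc.
    rewrite (@le_trans _ _ (d + Cf d * mu 1 * t))//; first by rewrite lerDr ltW.
    by rewrite ler_peMl// addr_ge0// ltW.
  split=> [t u t0 hu|].
    by have [y hy _] := adm t u (ltW t0) hu; exists y.
  (* The constant input 1 has positive norm for t > 0 and forces every bound to be nonnegative; the
     smallest one is therefore the infimum. *)
  pose S t := [set c | admissibility_bound j Tm1 B t c].
  have S0 t c : 0 < t -> S t c -> 0 <= c.
    move=> t0 Sc; have [h1 n1] := Linf_one t0.
    have [y hy _] := adm t _ (ltW t0) h1.
    have := Sc _ y h1 hy => /(le_trans (rnorm_ge0 y)).
    by rewrite pmulr_lge0.
  have Sinf t : 0 < t -> has_inf (S t).
    move=> t0; split; first by eexists; exact: (bound t 1 (ltW t0) ltr01).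
    by exists 0 => c; exact: S0.
  exists (fun t => inf (S t)); split.
    move=> t t0; split; last by move=> c' Sc; apply: ge_inf => //; exact: (Sinf t t0).2.
    (* For an input of norm 0 no quotient can be formed, but any finite bound already gives the
       claim. *)
    move=> u y hu hy; have [n0|n0] := eqVneq (Linf_norm t u) 0.
      have := bound t 1 (ltW t0) ltr01 u y hu hy.
      by rewrite n0 !mulr0.
    have np : 0 < Linf_norm t u by rewrite lt_def n0 Lu0.
    rewrite -ler_pdivrMr//; apply: lb_le_inf; first exact: (Sinf t t0).1.
    by move=> c Sc; rewrite ler_pdivrMr//; exact: Sc.
  apply/cvgrPdist_le => eps eps0.
  (* First [d] is chosen to make C d at most eps / 2, and only then [t], in terms of [Cf d]. *)
  have d0 : 0 < eps / 2 / (C + 1) by rewrite !divr_gt0// ltr_wpDl.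
  set d := eps / 2 / (C + 1) in d0.
  have D0 : 0 < C * (Cf d * mu 1) + 1.
    by rewrite ltr_wpDl// !mulr_ge0 ?mu0//; have [] := hCf d d0.
  near=> t.
  have t0 : 0 < t by near: t; exact: nbhs_right_gt.
  have te : t < eps / 2 / (C * (Cf d * mu 1) + 1).
    by near: t; apply: nbhs_right_lt; rewrite !divr_gt0.
  rewrite sub0r normrN ger0_norm; last first.
    by apply: lb_le_inf; [exact: (Sinf t t0).1 | move=> c; exact: S0].
  apply: (@le_trans _ _ (C * (d + Cf d * mu 1 * t))).
    by apply: ge_inf; [exact: (Sinf t t0).2 | exact: (bound t d (ltW t0) d0)].
  rewrite mulrDr (splitr eps) lerD//.
    rewrite (@le_trans _ _ ((C + 1) * d))//; first by rewrite ler_wpM2r ?(ltW d0)// lerDl.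
    by rewrite /d mulrC divfK// gt_eqF// ltr_wpDl.
  rewrite mulrA (@le_trans _ _ ((C * (Cf d * mu 1) + 1) * t))//.
    by rewrite ler_wpM2r ?(ltW t0)// lerDl.
  by rewrite mulrC -ler_pdivlMr// ltW.
Unshelve. all: by end_near. Qed.
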